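(* Let $\mathcal C$ be a fine tree decomposition of a compact metric space $K$. Then the associated tree system $\Theta_{\mathcal C}$ is a tree system of metric compacta, and its limit $\lim\Theta_{\mathcal C}$ is homeomorphic to $K$, via the map which is the identity on each domain $\Omega$ (a constituent space of $\Theta_{\mathcal C}$, viewed as a subset of $K$) and which sends the end of $T_{\mathcal C}$ represented by a ray $((A_1,H_1),(A_2,H_2),\dots)$ to the unique point of $\bigcap_i H_i$.
   Context: Trees: for a tree $T$, $V_T$ is its vertex set and $O_T$ its set of oriented edges; each $e\in O_T$ has initial vertex $\alpha(e)$, terminal vertex $\omega(e)$, and $\bar e$ denotes the reversed edge; $N_t=\{e:\alpha(e)=t\}$. A family of subsets of a compact metric space is null if for every $\epsilon>0$ only finitely many members have diameter $\ge\epsilon$. A tree system of metric compacta is $\Theta=(T,\{K_t\},\{\Sigma_e\},\{\phi_e\})$ with $T$ a countable tree, $K_t$ compact metric spaces, $\Sigma_e$ nonempty compact subsets of $K_{\alpha(e)}$, homeomorphisms $\phi_e:\Sigma_e\to\Sigma_{\bar e}$ with $\phi_{\bar e}=\phi_e^{-1}$, and each $\{\Sigma_e:e\in N_t\}$ a null family of pairwise disjoint sets. Its limit $\lim\Theta$: as a set, the quotient of $\bigsqcup_tK_t$ by $x\sim\phi_e(x)$, disjoint union with the set $E_T$ of ends of $T$; topology with basis the sets $G(U)$, where for a finite subtree $F$ with partial union $K_F$ (quotient of $\bigsqcup_{t\in V_F}K_t$ by the gluings along edges of $F$) and $N_F=\{e:\alpha(e)\in F,\omega(e)\notin F\}$,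 $U$ is an open subset of $K_F$ such that each $\Sigma_e$ ($e\in N_F$) is contained in or disjoint from $U$, and $G(U)$ is the union of $U$, all $K_t$ beyond edges $e\in N_F$ with $\Sigma_e\subset U$ (i.e. the shortest path from $F$ to $t$ starts with $e$), and all ends of rays leaving $F$ through such edges. Splittings: an elementary splitting of $K$ is a triple $(A,\{Y,Z\})$ of compact subsets with $Y\cup Z=K$, $Y\cap Z=A$, and $A$ a nonempty proper subset of both $Y$ and $Z$; $A$ is the separator, $Y,Z$ the halfspaces; for a halfspace $H$, $\dot H=H\setminus A$ and $H^c$ is the other halfspace. Two splittings do not cross if some halfspace of one is disjoint from some halfspace of the other. For pairwise noncrossing splittings, a separator $A'$ separates $A$ from $A''$ if for some halfspace $H$ of $A'$ we have $A\subset\dot H$ and $A''\subset\dot H^c$. A tree decomposition of $K$ is a family $\mathcal C=\{(A_\lambda,\{Y_\lambda,Z_\lambda\})\}_{\lambda\in\Lambda}$ of pairwise noncrossing elementary splittings which is discrete: for any two separators only finitely many separators separate them. It is fine if for each $\epsilon>0$ only finitely many $\lambda$ satisfy $\min(\mathrm{diam}Y_\lambda,\mathrm{diam}Z_\lambda)>\epsilon$. Domains: for a separator $A$ of $\mathcal C$ and a halfspace $H$ of it, let, for each $\lambda$ with $A_\lambda\ne A$, $H_\lambda$ be the halfspace of $A_\lambda$ containing $A$; let $\Lambda_{A,H}$ be the set of $\lambda$ with $H\not\subset H_\lambda$ such that no separator separates $A$ from $A_\lambda$; put $\Omega_{A,H}=H\cap\bigcap_{\lambda\in\Lambda_{A,H}}H_\lambda$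 ($=H$ if $\Lambda_{A,H}=\emptyset$). These sets are the domains. The dual tree $T_{\mathcal C}$ has the domains as vertices and pairs $(A,H)$ ($A$ a separator, $H$ one of its halfspaces) as oriented edges, with $\omega(A,H)=\Omega_{A,H}$ and $\overline{(A,H)}=(A,H^c)$ (so $\alpha(A,H)=\Omega_{A,H^c}$). The associated tree system $\Theta_{\mathcal C}$ has underlying tree $T_{\mathcal C}$, constituent space $\Omega$ at vertex $\Omega$, peripheral subspace $\Sigma_{(A,H)}=A$, and connecting maps $\phi_{(A,H)}=\mathrm{id}_A$. *)

(* Defs.v *)
From Stdlib Require Import Reals List Relations.
Open Scope R_scope.
Set Implicit Arguments.

Definition finitely_many {T : Type} (Pr : T -> Prop) : Prop :=
  exists l : list T, forall x, Pr x -> In x l.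

Definition incl_set {P : Type} (S1 S2 : P -> Prop) : Prop :=
  forall x, S1 x -> S2 x.

Definition is_metric_on {P : Type} (d : P -> P -> R) (S : P -> Prop) : Prop :=
  (forall x y, S x -> S y -> 0 <= d x y) /\
  (forall x y, S x -> S y -> (d x y = 0 <-> x = y)) /\
  (forall x y, S x -> S y -> d x y = d y x) /\
  (forall x y z, S x -> S y -> S z -> d x z <= d x y + d y z).

Definition compact_sub {P : Type} (d : P -> P -> R) (S : P -> Prop) : Prop :=
  forall (I : Type) (U : I -> P -> Prop),
    (forall i x, S x -> U i x ->
       exists eps, 0 < eps /\ forall y, S y -> d x y < eps -> U i y) ->
    (forall x, S x -> exists i, U i x) ->
    exists l : list I, forall x, S x -> exists i, In i l /\ U i x.

Definition diam_ge {P : Type} (d : P -> P -> R) (S : P -> Prop) (eps : R) : Prop :=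
  forall delta, delta < eps -> exists x y, S x /\ S y /\ delta < d x y.

Definition diam_gt {P : Type} (d : P -> P -> R) (S : P -> Prop) (eps : R) : Prop :=
  exists x y, S x /\ S y /\ eps < d x y.

Definition metric_open {X : Type} (d : X -> X -> R) (O : X -> Prop) : Prop :=
  forall x, O x -> exists eps, 0 < eps /\ forall y, d x y < eps -> O y.

(* ---------- trees (Serre's convention: oriented edges, reversal) ---------- *)

Fixpoint rpath {V O : Type} (al om : O -> V) (bar : O -> O)
    (u v : V) (prev : option O) (p : list O) : Prop :=
  match p with
  | nil => u = v
  | e :: q => al e = u /\
              match prev with Some f => e <> bar f | None => True end /\
              rpath al om bar (om e) v (Some e) q
  end.

Definition is_countable_tree {V O : Type} (al om : O -> V) (bar : O -> O) : Prop :=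
  (forall e, bar (bar e) = e) /\
  (forall e, bar e <> e) /\
  (forall e, al (bar e) = om e) /\
  (forall u v, exists p, rpath al om bar u v None p /\
                 forall p', rpath al om bar u v None p' -> p' = p) /\
  (exists f : V -> nat, forall u v, f u = f v -> u = v).

(* A tree system.  The family of spaces (K_t) is encoded non-dependently:
   a total type P with a projection vert : P -> V; K_t is the set of p with
   vert p = t and Kset p, with metric d restricted to it.  Sig e is a
   subset of K_{al e}; phi e is the connecting map (meaningful on Sig e). *)
Record TS := mkTS {
  tsV : Type;
  tsO : Type;
  tsal : tsO -> tsV;
  tsom : tsO -> tsV;
  tsbar : tsO -> tsO;
  tsP : Type;
  tsvert : tsP -> tsV;
  tsK : tsP -> Prop;
  tsd : tsP -> tsP -> R;
  tsSig : tsO -> tsP -> Prop;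
  tsphi : tsO -> tsP -> tsP
}.

Arguments tsal {t}. Arguments tsom {t}. Arguments tsbar {t}.
Arguments tsvert {t}. Arguments tsK {t}. Arguments tsd {t}.
Arguments tsphi {t}.

Definition Kt (T : TS) (t : tsV T) : tsP T -> Prop :=
  fun p => tsvert p = t /\ tsK p.
Arguments Kt {T}.

Definition tree_system_mc (T : TS) : Prop :=
  is_countable_tree (@tsal T) (@tsom T) (@tsbar T) /\
  (forall t, is_metric_on (@tsd T) (Kt t) /\ compact_sub (@tsd T) (Kt t)) /\
  (forall e, incl_set (tsSig T e) (Kt (tsal e)) /\
             (exists p, tsSig T e p) /\ compact_sub (@tsd T) (tsSig T e)) /\
  (forall e, (forall p, tsSig T e p -> tsSig T (tsbar e) (tsphi e p)) /\
             (forall p, tsSig T e p -> tsphi (tsbar e) (tsphi e p) = p) /\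
             (forall p, tsSig T e p -> forall eps, 0 < eps ->
                exists delta, 0 < delta /\
                  forall q, tsSig T e q -> tsd p q < delta ->
                    tsd (tsphi e p) (tsphi e q) < eps)) /\
  (forall t, (forall eps, 0 < eps ->
                finitely_many (fun e => tsal e = t /\ diam_ge (@tsd T) (tsSig T e) eps)) /\
             (forall e e', tsal e = t -> tsal e' = t -> e <> e' ->
                forall p, ~ (tsSig T e p /\ tsSig T e' p))).

Definition is_ray (T : TS) (r : nat -> tsO T) : Prop :=
  forall n, tsom (r n) = tsal (r (S n)) /\ r (S n) <> tsbar (r n).
Arguments is_ray {T}.

Definition ray_equiv (T : TS) (r r' : nat -> tsO T) : Prop :=
  exists k m, forall n, r (n + k)%nat = r' (n + m)%nat.
Arguments ray_equiv {T}.

(* raw points of the limit: points of the disjoint union, or rays *)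
Inductive LimPt (T : TS) : Type :=
| LPt : tsP T -> LimPt T
| LEnd : (nat -> tsO T) -> LimPt T.
Arguments LPt {T}.
Arguments LEnd {T}.

Definition lim_valid (T : TS) (x : LimPt T) : Prop :=
  match x with LPt p => tsK p | LEnd r => is_ray r end.
Arguments lim_valid {T}.

Definition glue (T : TS) (p q : tsP T) : Prop :=
  exists e, tsSig T e p /\ q = tsphi e p.
Arguments glue {T}.

Definition lim_rel (T : TS) (x y : LimPt T) : Prop :=
  match x, y with
  | LPt p, LPt q => clos_refl_sym_trans _ (@glue T) p q
  | LEnd r, LEnd r' => ray_equiv r r'
  | _, _ => False
  end.
Arguments lim_rel {T}.

Definition finite_subtree (T : TS) (F : tsV T -> Prop) : Prop :=
  finitely_many F /\ (exists v, F v) /\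
  (forall u v p, F u -> F v -> rpath (@tsal T) (@tsom T) (@tsbar T) u v None p ->
     forall e, In e p -> F (tsom e)).
Arguments finite_subtree {T}.

Definition NF (T : TS) (F : tsV T -> Prop) (e : tsO T) : Prop :=
  F (tsal e) /\ ~ F (tsom e).
Arguments NF {T}.

Definition beyond (T : TS) (e : tsO T) (t : tsV T) : Prop :=
  exists q, rpath (@tsal T) (@tsom T) (@tsbar T) (tsom e) t (Some e) q.
Arguments beyond {T}.

(* U is an open subset of the partial union K_F (a saturated subset of the
   disjoint union of the K_t, t in F, open in each K_t -- quotient topology),
   such that each Sig e, e in N_F, is contained in or disjoint from U *)
Definition admissible (T : TS) (F : tsV T -> Prop) (U : tsP T -> Prop) : Prop :=
  (forall p, U p -> F (tsvert p) /\ tsK p) /\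
  (forall e p, F (tsal e) -> F (tsom e) -> tsSig T e p -> U p -> U (tsphi e p)) /\
  (forall p, U p -> exists eps, 0 < eps /\
      forall q, Kt (tsvert p) q -> tsd p q < eps -> U q) /\
  (forall e, NF F e -> incl_set (tsSig T e) U \/
                       (forall p, tsSig T e p -> ~ U p)).
Arguments admissible {T}.

Definition Gset (T : TS) (F : tsV T -> Prop) (U : tsP T -> Prop) (x : LimPt T) : Prop :=
  match x with
  | LPt p => tsK p /\
      (U p \/ exists e, NF F e /\ incl_set (tsSig T e) U /\
                        ~ F (tsvert p) /\ beyond e (tsvert p))
  | LEnd r => is_ray r /\
      exists e, NF F e /\ incl_set (tsSig T e) U /\
        exists n0, forall n, (n0 <= n)%nat -> beyond e (tsal (r n))
  end.
Arguments Gset {T}.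

Definition lim_open (T : TS) (W : LimPt T -> Prop) : Prop :=
  forall x, W x -> exists F U, finite_subtree F /\ admissible F U /\
    Gset F U x /\ forall y, Gset F U y -> W y.
Arguments lim_open {T}.

Definition lim_homeo (T : TS) (X : Type) (dX : X -> X -> R) (h : LimPt T -> X) : Prop :=
  (forall x y, lim_valid x -> lim_valid y -> (h x = h y <-> lim_rel x y)) /\
  (forall z, exists x, lim_valid x /\ h x = z) /\
  (forall O, metric_open dX O -> lim_open (fun x => lim_valid x /\ O (h x))) /\
  (forall W, lim_open W -> metric_open dX (fun z => exists x, W x /\ h x = z)).
Arguments lim_homeo {T}.

Section Splittings.
Variables (X : Type) (dist : X -> X -> R) (L : Type) (A Y Z : L -> X -> Prop).

Definition half (e : L * bool) : X -> Prop :=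
  if snd e then Y (fst e) else Z (fst e).

Definition elementary_splitting (l : L) : Prop :=
  compact_sub dist (A l) /\ compact_sub dist (Y l) /\ compact_sub dist (Z l) /\
  (forall x, Y l x \/ Z l x) /\
  (forall x, A l x <-> (Y l x /\ Z l x)) /\
  (exists x, A l x) /\
  (exists y, Y l y /\ ~ A l y) /\ (exists z, Z l z /\ ~ A l z).

Definition noncrossing (l l' : L) : Prop :=
  exists b b', forall x, ~ (half (l, b) x /\ half (l', b') x).

Definition separates (m l l' : L) : Prop :=
  exists c, incl_set (A l) (fun x => half (m, c) x /\ ~ A m x) /\
            incl_set (A l') (fun x => half (m, negb c) x /\ ~ A m x).

Definition tree_decomposition : Prop :=
  (forall l, elementary_splitting l) /\
  (forall l l', l <> l' -> noncrossing l l') /\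
  (forall l l', finitely_many (fun m => separates m l l')).

Definition fine_decomposition : Prop :=
  forall eps, 0 < eps ->
    finitely_many (fun l => diam_gt dist (Y l) eps /\ diam_gt dist (Z l) eps).

(* the domain Omega_{A,H} for the edge e = (lambda, b), i.e. A = A_lambda,
   H = half e.  For lambda' with A_lambda' <> A, the halfspace H_lambda'
   is the halfspace half (lambda', b') containing A. *)
Definition Omega (e : L * bool) : X -> Prop :=
  fun x => half e x /\
    forall l' b',
      ~ (forall y, A l' y <-> A (fst e) y) ->
      incl_set (A (fst e)) (half (l', b')) ->
      ~ incl_set (half e) (half (l', b')) ->
      ~ (exists m, separates m (fst e) l') ->
      half (l', b') x.

Definition CV : Type := { D : X -> Prop | exists e, D = Omega e }.
Definition Cbar (e : L * bool) : L * bool := (fst e, negb (snd e)).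
Definition Com (e : L * bool) : CV := exist _ (Omega e) (ex_intro _ e eq_refl).
Definition Cal (e : L * bool) : CV := Com (Cbar e).

(* associated tree system Theta_C: constituent space at Omega is Omega
   (points (Omega, x) with x in Omega), Sig_(A,H) = A, phi = identity *)
Definition ThetaC : TS :=
  @mkTS CV (L * bool) Cal Com Cbar (CV * X)
    fst
    (fun p => proj1_sig (fst p) (snd p))
    (fun p q => dist (snd p) (snd q))
    (fun e p => fst p = Cal e /\ A (fst e) (snd p))
    (fun e p => (Com e, snd p)).

End Splittings.

(* Main.v *)
(** Write [e < f] for oriented edges when [H e] misses the halfspace opposite to [H f].  Two
    noncrossing splittings are comparable for exactly one choice of orientations, and discreteness
    makes intervals finite, so the relation [f] covers [e] describes the tree: [Omega e] is cut
    out of [H e] by the halfspaces opposite to the elements covered by [e], and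
    [Omega e = Omega f] iff [e = f] or [Cbar f] is covered by [e].  Reduced paths and rays are
    then the saturated descending chains of edges, and a vertex lies beyond [e] iff its domain
    is contained in [H e].

    Fineness forces the halfspaces along a ray to shrink to a point, and makes the halfspaces
    [H e] that leave a finite subtree [F] a null family.  Up to finitely many, such an [H e] near
    a point of the partial union of [F] is small and lies near its separator, which gives
    both openness and continuity of the map. *)

Require Import Defs.
From Stdlib Require Import Reals List Relations.
From Stdlib Require Import FunctionalExtensionality PropExtensionality.
From Stdlib Require Import ClassicalEpsilon IndefiniteDescription.
From Stdlib Require Import Lra Lia Cantor FinFun.
Open Scope R_scope.

(** * Finite lists: positive bounds and the pigeonhole principle *)

Lemma positive_lower_bound (l : list R) :
  exists m, 0 < m /\ forall r, In r l -> 0 < r -> m <= r.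
Proof.
  induction l as [| a l (m & Hm & IH)].
  - exists 1; split; [lra | intros r []].
  - destruct (Rlt_le_dec 0 a) as [Ha | Ha].
    + exists (Rmin a m); split; [now apply Rmin_pos |].
      intros r [<- | Hr] Hp; [apply Rmin_l |].
      apply Rle_trans with m; [apply Rmin_r | auto].
    + exists m; split; auto; intros r [<- | Hr] Hp; [lra | auto].
Qed.

Lemma injection_not_in_list {T : Type} (f : nat -> T) (l : list T) :
  (forall n m, f n = f m -> n = m) -> (forall n, In (f n) l) -> False.
Proof.
  intros Hi Hl.
  assert (N : NoDup (map f (seq 0 (S (length l))))).
  { apply Injective_map_NoDup; [exact Hi | apply seq_NoDup]. }
  apply NoDup_incl_length with (l' := l) in N.
  - rewrite length_map, length_seq in N; lia.
  - intros x Hx; apply in_map_iff in Hx; destruct Hx as (n & <- & _); auto.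
Qed.

Lemma finitely_many_sub {T : Type} (P Q : T -> Prop) :
  (forall x, P x -> Q x) -> finitely_many Q -> finitely_many P.
Proof. intros S [l Hl]; exists l; auto. Qed.

Lemma diam_gt_mono {X : Type} (d : X -> X -> R) (S1 S2 : X -> Prop) (eps eps' : R) :
  incl_set S1 S2 -> eps' <= eps -> diam_gt d S1 eps -> diam_gt d S2 eps'.
Proof. intros HS He (x & y & Hx & Hy & Hd); exists x, y; repeat split; auto; lra. Qed.

(** * Compactness in metric spaces *)

Section Metric.

Context {X : Type} {dist : X -> X -> R}.
Hypothesis Hm : is_metric_on dist (fun _ => True).

Lemma dist_sym x y : dist x y = dist y x.
Proof. destruct Hm as (_ & _ & H & _); auto. Qed.

Lemma dist_triangle x y z : dist x z <= dist x y + dist y z.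
Proof. destruct Hm as (_ & _ & _ & H); auto. Qed.

Lemma dist_self x : dist x x = 0.
Proof. destruct Hm as (_ & H & _); now apply H. Qed.

Lemma dist_pos x y : x <> y -> 0 < dist x y.
Proof.
  destruct Hm as (H & H0 & _); intro N.
  destruct (H x y I I) as [| E]; auto; exfalso; apply N, H0; auto.
Qed.

Lemma compact_avoid (S : X -> Prop) z : compact_sub dist S -> ~ S z ->
  exists eps, 0 < eps /\ forall y, dist z y < eps -> ~ S y.
Proof.
  intros Hc Hz.
  (* The complements of the closed balls of positive radius around [z] cover [S]; a positive lower
     bound for the radii in a finite subcover is the required [eps]. *)
  destruct (Hc R (fun r y => 0 < r /\ r < dist z y)) as [l Hl].
  - intros r x _ [Hr Hx]; exists (dist z x - r); split; [lra |].
    intros y _ Hy; split; auto.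
    pose proof (dist_triangle z y x); rewrite (dist_sym y x) in *; lra.
  - intros x Hx; exists (dist z x / 2).
    assert (0 < dist z x) by (apply dist_pos; congruence); lra.
  - destruct (positive_lower_bound l) as (m & Hp & Hle).
    exists m; split; auto; intros y Hy HS.
    destruct (Hl y HS) as (r & Hr & H0 & H1); specialize (Hle r Hr H0); lra.
Qed.

Lemma closed_compact (S : X -> Prop) : compact_sub dist (fun _ => True) ->
  (forall x, ~ S x -> exists eps, 0 < eps /\ forall y, dist x y < eps -> ~ S y) ->
  compact_sub dist S.
Proof.
  intros HX HS J U HU Hcov.
  (* The complement of [S] joins the cover as [None]. The sets [U i] are open only relative to [S],
     so each is replaced by the points having a ball whose trace on [S] lies in [U i]. *)
  set (W := fun (o : option J) (x : X) => match o with
    | Some i => exists eps, 0 < eps /\ forall y, S y -> dist x y < eps -> U i y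
    | None => ~ S x end).
  destruct (HX (option J) W) as [l Hl].
  - intros [i |] x _ Hx; unfold W in *.
    + destruct Hx as (eps & He & Hx); exists (eps / 2); split; [lra |].
      intros y _ Hy; exists (eps / 2); split; [lra |]; intros w Hw Hyw; apply Hx; auto.
      pose proof (dist_triangle x y w); lra.
    + destruct (HS x Hx) as (eps & He & Hn); exists eps; split; auto.
  - intros x _; destruct (classic (S x)) as [Sx | N].
    + destruct (Hcov x Sx) as [i Hi]; exists (Some i); exact (HU i x Sx Hi).
    + exists None; exact N.
  - exists (flat_map (fun o => match o with Some i => i :: nil | None => nil end) l).
    intros x Sx; destruct (Hl x I) as ([i |] & Hi & Wx); [| contradiction].
    exists i; split.
    + apply in_flat_map; exists (Some i); simpl; auto.
    + destruct Wx as (eps & He & Wx); apply Wx; auto; now rewrite dist_self.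
Qed.

Lemma avoid_finite {T : Type} (S : T -> X -> Prop) z (l : list T) :
  (forall t, compact_sub dist (S t)) ->
  exists eps, 0 < eps /\ forall t y, In t l -> ~ S t z -> dist z y < eps -> ~ S t y.
Proof.
  intro Hc; induction l as [| a l (m & Hp & IH)].
  - exists 1; split; [lra | intros t y []].
  - destruct (classic (S a z)) as [Ha | Ha].
    + exists m; split; auto; intros t y [<- | Ht] N; [contradiction | eauto].
    + destruct (compact_avoid (S a) z (Hc a) Ha) as (eps & He & Hy).
      exists (Rmin eps m); split; [now apply Rmin_pos |].
      pose proof (Rmin_l eps m); pose proof (Rmin_r eps m).
      intros t y [<- | Ht] N D; [apply Hy | eapply IH; eauto]; lra.
Qed.

End Metric.

(** * The order on oriented edges *)

Lemma Cbar_involutive {L : Type} (e : L * bool) : Cbar (Cbar e) = e.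
Proof. destruct e as [l b]; unfold Cbar; simpl; now rewrite Bool.negb_involutive. Qed.

Lemma Cbar_neq {L : Type} (e : L * bool) : Cbar e <> e.
Proof. destruct e as [l []]; unfold Cbar; simpl; congruence. Qed.

Lemma same_index_edges {L : Type} (e f : L * bool) :
  fst e = fst f -> e = f \/ e = Cbar f.
Proof.
  destruct e as [l []], f as [m []]; unfold Cbar; simpl; intros ->; auto.
Qed.

Section Decomposition.

Context {X : Type} {dist : X -> X -> R} {L : Type} {A Y Z : L -> X -> Prop}.
Hypothesis HT : tree_decomposition dist A Y Z.

Notation H := (half Y Z).
Notation Dom := (Omega A Y Z).
Notation bar := Cbar.

Lemma half_cover e x : H e x \/ H (bar e) x.
Proof.
  destruct HT as [HE _], e as [l []]; destruct (HE l) as (_ & _ & _ & Hc & _);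
    unfold half, Cbar; simpl; destruct (Hc x); auto.
Qed.

Lemma half_inter e x : A (fst e) x <-> H e x /\ H (bar e) x.
Proof.
  destruct HT as [HE _], e as [l []]; destruct (HE l) as (_ & _ & _ & _ & Hi & _);
    unfold half, Cbar; simpl; rewrite Hi; tauto.
Qed.

Lemma separator_half e x : A (fst e) x -> H e x.
Proof. rewrite half_inter; tauto. Qed.

Lemma separator_half_bar e x : A (fst e) x -> H (bar e) x.
Proof. rewrite half_inter; tauto. Qed.

Lemma separator_nonempty l : exists x, A l x.
Proof. destruct HT as [HE _], (HE l) as (_ & _ & _ & _ & _ & Hn & _); exact Hn. Qed.

Lemma half_proper e : exists x, H e x /\ ~ A (fst e) x.
Proof.
  destruct HT as [HE _], e as [l []]; destruct (HE l) as (_ & _ & _ & _ & _ & _ & Hy & Hz);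
    assumption.
Qed.

Lemma half_compact e : compact_sub dist (H e).
Proof.
  destruct HT as [HE _], e as [l []]; destruct (HE l) as (_ & Hy & Hz & _); assumption.
Qed.

Definition lt (e f : L * bool) : Prop := forall x, H e x -> ~ H (bar f) x.

Lemma lt_sub e f x : lt e f -> H e x -> H f x.
Proof. intros l Hx; destruct (half_cover f x); auto; exfalso; eapply l; eauto. Qed.

Lemma lt_trans e f g : lt e f -> lt f g -> lt e g.
Proof. intros l1 l2 x Hx; apply l2; eapply lt_sub; eauto. Qed.

Lemma lt_bar e f : lt e f -> lt (bar f) (bar e).
Proof. intros l x Hx; rewrite Cbar_involutive; intro; eapply l; eauto. Qed.

Lemma lt_bar_r e f : lt e (bar f) -> lt f (bar e).
Proof. intro l; rewrite <- (Cbar_involutive f); now apply lt_bar. Qed.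

Lemma lt_bar_l e f : lt (bar e) f -> lt (bar f) e.
Proof. intro l; rewrite <- (Cbar_involutive e); now apply lt_bar. Qed.

Lemma lt_bar_b e f : lt (bar e) (bar f) -> lt f e.
Proof. intro l; rewrite <- (Cbar_involutive e); now apply lt_bar_r. Qed.

Lemma lt_irrefl e : ~ lt e e.
Proof.
  intro l; destruct (separator_nonempty (fst e)) as [x Hx].
  apply (l x); [apply separator_half | apply separator_half_bar]; assumption.
Qed.

Lemma lt_asym e f : lt e f -> lt f e -> False.
Proof. intros l1 l2; exact (lt_irrefl _ (lt_trans _ _ _ l1 l2)). Qed.

Lemma lt_both_targets e f : lt e f -> lt e (bar f) -> False.
Proof.
  intros l1 l2; destruct (separator_nonempty (fst e)) as [x Hx].
  apply separator_half in Hx; apply (l1 x Hx); eapply lt_sub; eauto.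
Qed.

Lemma lt_both_sources e f : lt e f -> lt (bar e) f -> False.
Proof. intros l1 l2; apply (lt_both_targets (bar f) e); [now apply lt_bar_l | now apply lt_bar]. Qed.

Lemma lt_index e f : lt e f -> fst e <> fst f.
Proof.
  intros l E; destruct (same_index_edges _ _ E) as [-> | ->].
  - exact (lt_irrefl _ l).
  - destruct (half_proper (bar f)) as (x & Hx & Hn).
    exact (l x Hx Hx).
Qed.

(** Each splitting has two halfspaces, so the disjoint pair given by noncrossing is one of four; the
    case [lt (bar e) (bar f)] appears in the reversed form [lt f e]. *)
Lemma lt_tetra e f : fst e <> fst f ->
  lt e f \/ lt e (bar f) \/ lt (bar e) f \/ lt f e.
Proof.
  intro N; destruct HT as (_ & Hn & _).
  destruct (Hn _ _ N) as (b & b' & Hd).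
  assert (l : lt (fst e, b) (fst f, negb b')).
  { intros x Hx Hy; apply (Hd x); split; auto.
    unfold Cbar in Hy; simpl in Hy; now rewrite Bool.negb_involutive in Hy. }
  destruct (same_index_edges (fst e, b) e eq_refl) as [E1 | E1];
  destruct (same_index_edges (fst f, negb b') f eq_refl) as [E2 | E2];
  rewrite E1, E2 in l; auto using lt_bar_b.
Qed.

Lemma separators_disjoint l m x : A l x -> A m x -> l = m.
Proof.
  intros H1 H2; apply NNPP; intro N.
  destruct (lt_tetra (l, true) (m, true) N) as [k | [k | [k | k]]].
  - apply (k x); [now apply separator_half | now apply separator_half_bar].
  - apply (k x); [now apply separator_half | rewrite Cbar_involutive; now apply separator_half].
  - apply (k x); [now apply separator_half_bar | now apply separator_half_bar].
  - apply (k x); [now apply separator_half | now apply separator_half_bar].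
Qed.

(** The arguments stand in the order of [lt]: [f] is an immediate predecessor of [e]. In the dual
    tree, [f] is then an edge that can follow [e] on a reduced path. *)
Definition cov (f e : L * bool) : Prop :=
  lt f e /\ forall g, lt f g -> lt g e -> False.

Lemma cov_bar f e : cov f e -> cov (bar e) (bar f).
Proof.
  intros [l n]; split; [now apply lt_bar | intros g l1 l2].
  exact (n (bar g) (lt_bar_r _ _ l2) (lt_bar_l _ _ l1)).
Qed.

Lemma cov_bar_l f e : cov (bar f) e -> cov (bar e) f.
Proof. intro c; rewrite <- (Cbar_involutive f); now apply cov_bar. Qed.

(** This turns discreteness into finiteness of intervals. With its converse [separates_between], it
    also translates the clause on separators in [Omega] into the covering relation. *)
Lemma lt_separates e f g : lt f g -> lt g e -> separates A Y Z (fst g) (fst e) (fst f).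
Proof.
  intros l1 l2.
  assert (E : forall b, g = (fst g, b) -> separates A Y Z (fst g) (fst e) (fst f)).
  { intros b E; exists (negb b); split; intros x Hx.
    - assert (Hn : ~ H g x).
      { intro Hg; apply (l2 x Hg); now apply separator_half_bar. }
      split; [| intro Ha; apply Hn, separator_half, Ha].
      destruct (half_cover g x) as [| Hg]; [contradiction |].
      rewrite E in Hg; exact Hg.
    - apply (separator_half f) in Hx.
      rewrite Bool.negb_involutive, <- E; split; [eapply lt_sub; eauto |].
      intro Ha; apply (l1 x Hx), separator_half_bar, Ha. }
  destruct g as [m b]; exact (E b eq_refl).
Qed.

Lemma separates_between e f m : lt f e -> separates A Y Z m (fst e) (fst f) ->
  exists g, fst g = m /\ lt f g /\ lt g e.
Proof.
  intros l (c & He & Hf); exists (m, negb c).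
  set (g := (m, negb c)) in *.
  assert (E : (m, c) = bar g) by (unfold g, Cbar; simpl; now rewrite Bool.negb_involutive).
  rewrite E in He.
  destruct (separator_nonempty (fst e)) as [a Ha].
  destruct (separator_nonempty (fst f)) as [b Hb].
  destruct (He a Ha) as [He1 He2]; destruct (Hf b Hb) as [Hf1 Hf2].
  assert (Ne : ~ H g a) by (intro; apply He2, (half_inter g); auto).
  assert (Nf : ~ H (bar g) b) by (intro; apply Hf2, (half_inter g); auto).
  assert (I1 : fst g <> fst e) by (intro E1; apply He2; simpl in E1; now rewrite E1).
  assert (I2 : fst f <> fst g) by (intro E1; apply Hf2; simpl in E1; now rewrite <- E1).
  assert (C1 : lt g e \/ lt g (bar e)).
  { destruct (lt_tetra g e I1) as [k | [k | [k | k]]]; auto; exfalso.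
    - apply (k a He1); now apply separator_half_bar.
    - apply Ne, (lt_sub e g _ k); now apply separator_half. }
  assert (C2 : lt f g \/ lt (bar f) g).
  { destruct (lt_tetra f g I2) as [k | [k | [k | k]]]; auto; exfalso.
    - apply Nf, (lt_sub f (bar g) _ k); now apply separator_half.
    - apply (k b Hf1); now apply separator_half_bar. }
  split; [reflexivity |].
  destruct C1 as [C1 | C1], C2 as [C2 | C2]; auto; exfalso.
  - exact (lt_both_sources f e l (lt_trans _ _ _ C2 C1)).
  - exact (lt_both_targets f e l (lt_trans _ _ _ C2 C1)).
  - exact (lt_asym e f (lt_bar_b _ _ (lt_trans _ _ _ C2 C1)) l).
Qed.

(** A halfspace [half (l', b')] occurring in [Omega e] contains the separator of [e] but not all of
    [H e]. This forces the opposite edge below [e], and the absence of intermediate separators makes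
    that edge one covered by [e]. *)
Lemma DomE e x : Dom e x <-> H e x /\ forall f, cov f e -> H (bar f) x.
Proof.
  split; intros [Hx Hall]; split; auto.
  - intros f c; destruct (c) as [l n].
    assert (F : bar f = (fst f, negb (snd f))) by reflexivity.
    rewrite F; apply Hall; rewrite <- ?F.
    + intro E; destruct (separator_nonempty (fst f)) as [y Hy].
      apply (l y); [now apply separator_half | apply separator_half_bar; now apply E].
    + intros y Hy; apply (lt_sub (bar e) _ _ (lt_bar _ _ l)); now apply separator_half_bar.
    + intro Hs; destruct (half_proper f) as (y & Hy & Hn).
      apply Hn, half_inter; split; auto; apply Hs; eapply lt_sub; eauto.
    + intros [m Hm].
      destruct (separates_between _ _ _ l Hm) as (g & _ & l1 & l2).
      exact (n g l1 l2).
  - intros m b' NA Hin Nin Nsep.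
    set (f := (m, negb b')) in *.
    assert (E : (m, b') = bar f) by (unfold f, Cbar; simpl; now rewrite Bool.negb_involutive).
    rewrite E in *; apply Hall.
    destruct (separator_nonempty (fst e)) as [a Ha].
    assert (I : fst f <> fst e) by (intro I; apply NA; simpl in I; now rewrite I).
    assert (l : lt f e).
    { destruct (lt_tetra f e I) as [k | [k | [k | k]]]; auto; exfalso.
      - apply Nin; intros y Hy; apply (lt_sub e (bar f)); auto; now apply lt_bar_r.
      - apply (k a); [now apply Hin | now apply separator_half_bar].
      - apply (k a); [now apply separator_half | now apply Hin]. }
    split; auto; intros g l1 l2; apply Nsep.
    exists (fst g); exact (lt_separates e f g l1 l2).
Qed.

Lemma Dom_half e x : Dom e x -> H e x.
Proof. rewrite DomE; tauto. Qed.

Lemma separator_Dom e x : A (fst e) x -> Dom e x.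
Proof.
  intro Ha; rewrite DomE; split; [now apply separator_half |].
  intros f [l _]; apply (lt_sub (bar e)); [now apply lt_bar |]; now apply separator_half_bar.
Qed.

(** * When two edges have the same domain *)

Definition same_vertex (e f : L * bool) : Prop := e = f \/ cov (bar f) e.

Lemma same_vertex_sym e f : same_vertex e f -> same_vertex f e.
Proof. intros [-> | c]; [now left | right; now apply cov_bar_l]. Qed.

(** Apart from [bar e], every edge covered by [f] is covered by [e], so the halfspaces that cut out
    the domain of [f] all occur among those of [e]. *)
Lemma cov_Dom_sub e f x : cov (bar f) e -> Dom e x -> Dom f x.
Proof.
  intros c D; pose proof D as D'; rewrite DomE in D'; rewrite DomE.
  destruct D' as [De Dc]; destruct (c) as [l n].
  split; [rewrite <- (Cbar_involutive f); now apply Dc |].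
  intros g [l1 n1].
  destruct (classic (fst g = fst e)) as [E | I].
  - destruct (same_index_edges _ _ E) as [-> | ->]; [| now rewrite Cbar_involutive].
    exfalso; exact (lt_both_sources e f l1 (lt_bar_l _ _ l)).
  - destruct (lt_tetra g e I) as [k | [k | [k | k]]].
    + apply Dc; split; auto; intros h k1 k2.
      destruct (classic (fst h = fst f)) as [E' | I'].
      * destruct (same_index_edges _ _ E') as [-> | ->].
        -- exact (lt_both_sources f e k2 l).
        -- exact (lt_both_targets g f l1 k1).
      * destruct (lt_tetra h f I') as [j | [j | [j | j]]].
        -- exact (n1 h k1 j).
        -- exact (lt_both_targets g f l1 (lt_trans _ _ _ k1 j)).
        -- exact (n h (lt_bar_l _ _ j) k2).
        -- exact (lt_both_sources f e (lt_trans _ _ _ j k2) l).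
    + exfalso; exact (n1 (bar e) k (lt_bar_l _ _ l)).
    + exfalso; exact (n (bar g) (lt_bar _ _ l1) k).
    + exfalso; exact (lt_both_sources e f (lt_trans _ _ _ k l1) (lt_bar_l _ _ l)).
Qed.

Lemma same_vertex_Dom e f x : same_vertex e f -> Dom e x -> Dom f x.
Proof. intros [-> | c]; auto; now apply cov_Dom_sub. Qed.

Lemma covers_disjoint e f g : cov f e -> cov g e -> f <> g -> lt f (bar g).
Proof.
  intros [l1 n1] [l2 n2] N.
  destruct (classic (fst f = fst g)) as [E | I].
  - destruct (same_index_edges _ _ E) as [-> | ->]; [contradiction |].
    exfalso; exact (lt_both_sources g e l2 l1).
  - destruct (lt_tetra f g I) as [k | [k | [k | k]]]; auto; exfalso.
    + exact (n1 g k l2).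
    + exact (lt_both_sources f e l1 (lt_trans _ _ _ k l2)).
    + exact (n2 f k l1).
Qed.

(** If [e] covers some [f], the separator of [f] lies in the domain and misses that of [e];
    otherwise the domain is all of [H e], which exceeds its separator. *)
Lemma Dom_not_separator e : exists x, Dom e x /\ ~ A (fst e) x.
Proof.
  destruct (classic (exists f, cov f e)) as [[f c] | N].
  - destruct (separator_nonempty (fst f)) as [a Ha]; exists a; split.
    + apply (same_vertex_Dom (bar f) e).
      * right; now apply cov_bar.
      * exact (separator_Dom (bar f) a Ha).
    + intro He; apply (proj1 c a); [now apply separator_half | now apply separator_half_bar].
  - destruct (half_proper e) as (x & Hx & Hn); exists x; split; auto.
    rewrite DomE; split; auto; intros f c; exfalso; apply N; eauto.
Qed.

Lemma between_list f e : lt f e -> exists l, forall g, lt f g -> lt g e -> In (fst g) l.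
Proof.
  intro k; destruct HT as (_ & _ & Hf); destruct (Hf (fst e) (fst f)) as [l Hl].
  exists l; intros g l1 l2; apply Hl; now apply lt_separates.
Qed.

(* The separators between [f] and [e] are listed; removing one from the list splits the interval. *)
Lemma interval_ind (P : L * bool -> L * bool -> Prop) :
  (forall f e, cov f e -> P f e) ->
  (forall f g e, lt f g -> lt g e -> P f g -> P g e -> P f e) ->
  forall f e, lt f e -> P f e.
Proof.
  intros Hc Hs f e k; destruct (between_list f e k) as [l Hl].
  revert f e k Hl; induction l as [| a l IH]; intros f e k Hl.
  - apply Hc; split; auto; intros g l1 l2; exact (Hl g l1 l2).
  - destruct (classic (exists g, fst g = a /\ lt f g /\ lt g e)) as [(g & E & l1 & l2) | N].
    + apply (Hs f g e); auto; apply IH; auto; intros h k1 k2.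
      * destruct (Hl h k1 (lt_trans _ _ _ k2 l2)) as [E' |]; auto.
        exfalso; apply (lt_index _ _ k2); congruence.
      * destruct (Hl h (lt_trans _ _ _ l1 k1) k2) as [E' |]; auto.
        exfalso; apply (lt_index _ _ k1); congruence.
    + apply IH; auto; intros g l1 l2; destruct (Hl g l1 l2) as [E' |]; auto.
      exfalso; apply N; eauto.
Qed.

Lemma lt_cov f e : lt f e -> exists g, (f = g \/ lt f g) /\ cov g e.
Proof.
  revert f e; apply interval_ind.
  - intros f e c; eauto.
  - intros f g e l1 l2 _ (h & [<- | k] & c); eauto using lt_trans.
Qed.

Lemma lt_Dom e g x : lt g e -> Dom e x -> H (bar g) x.
Proof.
  intros l D; destruct (lt_cov _ _ l) as (h & k & c).
  rewrite DomE in D; destruct D as [_ D]; specialize (D h c).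
  destruct k as [<- | k]; auto; exact (lt_sub _ _ _ (lt_bar _ _ k) D).
Qed.

Lemma Dom_eq_not_lt e f : (forall x, Dom e x <-> Dom f x) -> lt e f -> False.
Proof.
  intros E l; destruct (Dom_not_separator e) as (x & Hx & Hn).
  apply Hn, half_inter; split; [now apply Dom_half |].
  apply (lt_Dom f); auto; now apply E.
Qed.

Lemma Dom_eq_same_vertex e f : (forall x, Dom e x <-> Dom f x) -> same_vertex e f.
Proof.
  intro E; apply NNPP; intro N.
  destruct (Dom_not_separator e) as (x & Hx & Hn).
  destruct (classic (fst e = fst f)) as [I | I].
  - destruct (same_index_edges _ _ I) as [-> | ->]; [apply N; now left |].
    apply Hn; simpl; apply half_inter; split;
      [apply Dom_half; now apply E | now apply Dom_half].
  - destruct (lt_tetra e f I) as [k | [k | [k | k]]].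
    + exact (Dom_eq_not_lt _ _ E k).
    + apply (k x); [now apply Dom_half |].
      rewrite Cbar_involutive; apply Dom_half; now apply E.
    (* Here [g] is covered by [e] and equals [bar f] or lies above it. If strictly above, the common
       domain of [e] and [f], which is also that of [bar g], would lie in the separator of [g]. *)
    + destruct (lt_cov _ _ (lt_bar_l _ _ k)) as (g & [<- | k1] & c); [apply N; now right |].
      assert (S : same_vertex e (bar g)) by (right; now rewrite Cbar_involutive).
      destruct (Dom_not_separator (bar g)) as (y & Hy & Hny).
      apply Hny; rewrite half_inter; split; [now apply Dom_half |].
      apply (lt_Dom f); [now apply lt_bar_l |].
      apply E; exact (same_vertex_Dom _ _ _ (same_vertex_sym _ _ S) Hy).
    + apply (Dom_eq_not_lt f e); auto; intro; symmetry; apply E.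
Qed.

(** * Descending chains of edges *)

Hypothesis Hm : is_metric_on dist (fun _ => True).
Hypothesis HX : compact_sub dist (fun _ => True).
Hypothesis HF : fine_decomposition dist Y Z.

Lemma Dom_closed e x : ~ Dom e x ->
  exists eps, 0 < eps /\ forall y, dist x y < eps -> ~ Dom e y.
Proof.
  intro N; rewrite DomE in N.
  assert (C : exists f, ~ H f x /\ forall y, Dom e y -> H f y).
  { destruct (classic (H e x)) as [He | He]; [| exists e; split; [assumption | apply Dom_half]].
    apply NNPP; intro N'; apply N; split; auto; intros f c; apply NNPP; intro Nf.
    apply N'; exists (bar f); split; auto; intros y Hy.
    exact (proj2 (proj1 (DomE _ _) Hy) f c). }
  destruct C as (f & Nf & Hf).
  destruct (compact_avoid Hm _ _ (half_compact f) Nf) as (eps & He & Hy).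
  exists eps; split; auto; intros y D Dy; exact (Hy y D (Hf y Dy)).
Qed.

Lemma Dom_compact e : compact_sub dist (Dom e).
Proof. apply (closed_compact Hm); auto; apply Dom_closed. Qed.

(** A halfspace containing a given domain thus has diameter above a fixed positive bound. In this
    way fineness, which concerns the smaller of two diameters, controls the opposite halfspace. *)
Lemma Dom_two_points e : exists x y, Dom e x /\ Dom e y /\ 0 < dist x y.
Proof.
  destruct (separator_nonempty (fst e)) as [x Hx].
  destruct (Dom_not_separator e) as (y & Hy & N); exists x, y; split; [| split; auto].
  - now apply separator_Dom.
  - apply (dist_pos Hm); congruence.
Qed.

Lemma fine_edges eps : 0 < eps ->
  finitely_many (fun e => diam_gt dist (H e) eps /\ diam_gt dist (H (bar e)) eps).
Proof.
  intro He; destruct (HF eps He) as [l Hl].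
  exists (flat_map (fun m => (m, true) :: (m, false) :: nil) l).
  intros [m b] D; apply in_flat_map; exists m; split.
  - apply Hl; destruct b, D; auto.
  - destruct b; simpl; auto.
Qed.

Lemma chain_lt r n m : (forall i, cov (r (S i)) (r i)) -> (n < m)%nat -> lt (r m) (r n).
Proof.
  intros c k; induction k as [| m k IH]; [apply c |].
  eapply lt_trans; [apply c | exact IH].
Qed.

Lemma chain_sub r n m x : (forall i, cov (r (S i)) (r i)) -> (n <= m)%nat ->
  H (r m) x -> H (r n) x.
Proof.
  intros c k Hx; destruct (PeanoNat.Nat.eq_dec n m) as [-> | N]; auto.
  apply (lt_sub (r m)); auto; apply chain_lt; auto; lia.
Qed.

(** Every [H (bar (r n))] contains the domain of [bar (r 0)], hence two fixed points. If no
    [H (r n)] were small, infinitely many splittings would have both halfspaces of diameter above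
    [dl], against fineness. *)
Lemma chain_small r eps : (forall i, cov (r (S i)) (r i)) -> 0 < eps ->
  exists N, forall n x y, (N <= n)%nat -> H (r n) x -> H (r n) y -> dist x y < eps.
Proof.
  intros c He; destruct (Dom_two_points (bar (r 0%nat))) as (a & b & Ha & Hb & Hab).
  apply Dom_half in Ha; apply Dom_half in Hb.
  set (dl := Rmin eps (dist a b) / 2).
  assert (Hd : 0 < Rmin eps (dist a b)) by now apply Rmin_pos.
  pose proof (Rmin_l eps (dist a b)) as M1; pose proof (Rmin_r eps (dist a b)) as M2.
  destruct (fine_edges dl) as [l Hl]; [unfold dl; lra |].
  apply NNPP; intro NN; apply (injection_not_in_list r l).
  - intros n m E; destruct (PeanoNat.Nat.lt_trichotomy n m) as [k | [k | k]]; auto;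
      exfalso; apply (chain_lt r) in k; auto; rewrite E in k; exact (lt_irrefl _ k).
  - intro n; apply Hl; split.
    + apply NNPP; intro ND; apply NN; exists n; intros m x y k Hx Hy.
      destruct (Rle_lt_dec eps (dist x y)) as [D | D]; auto; exfalso; apply ND.
      exists x, y; repeat split; try (eapply chain_sub; eauto); unfold dl; lra.
    + exists a, b; repeat split; [| | unfold dl; lra];
      destruct n as [| n]; auto;
      eapply lt_sub; eauto; apply lt_bar, chain_lt; auto; lia.
Qed.

Lemma chain_point r : (forall i, cov (r (S i)) (r i)) -> exists z, forall i, H (r i) z.
Proof.
  intro c; apply NNPP; intro N.
  destruct (HX nat (fun i x => ~ H (r i) x)) as [l Hl].
  - intros i x _ Hx; destruct (compact_avoid Hm _ _ (half_compact (r i)) Hx) as (eps & He & Hy).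
    exists eps; split; auto.
  - intros x _; apply not_all_ex_not; intro Hx; apply N; eauto.
  (* [H (r (list_max l))] is contained in every listed halfspace, so a point of its separator
     escapes the finite subcover. *)
  - destruct (separator_nonempty (fst (r (list_max l)))) as [x Hx].
    apply separator_half in Hx.
    destruct (Hl x I) as (i & Hi & Ni); apply Ni; apply (chain_sub r i (list_max l)); auto.
    pose proof (proj1 (list_max_le l (list_max l)) (PeanoNat.Nat.le_refl _)) as F.
    rewrite Forall_forall in F; auto.
Qed.

Lemma chain_point_unique r x y : (forall i, cov (r (S i)) (r i)) ->
  (forall i, H (r i) x) -> (forall i, H (r i) y) -> x = y.
Proof.
  intros c Hx Hy; apply NNPP; intro N; apply (dist_pos Hm) in N.
  destruct (chain_small r _ c N) as [n Hn].
  specialize (Hn n x y (PeanoNat.Nat.le_refl _) (Hx n) (Hy n)); lra.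
Qed.

Lemma chain_point_interior r z i : (forall i, cov (r (S i)) (r i)) ->
  (forall i, H (r i) z) -> ~ H (bar (r i)) z.
Proof. intros c Hz; apply (proj1 (c i)), Hz. Qed.

(** Once [H (r n)] is too small to contain both of two fixed points of the domain of [e], or both of
    two such points for [bar e], it contains neither halfspace of [e], and only the stated orders
    remain. *)
Lemma chain_eventually r e : (forall i, cov (r (S i)) (r i)) ->
  exists n, lt (r n) e \/ lt (r n) (bar e).
Proof.
  intro c.
  destruct (Dom_two_points e) as (a & b & Ha & Hb & Hab).
  destruct (Dom_two_points (bar e)) as (a' & b' & Ha' & Hb' & Hab').
  apply Dom_half in Ha, Hb, Ha', Hb'.
  destruct (chain_small r (Rmin (dist a b) (dist a' b')) c) as [n Hn]; [now apply Rmin_pos |].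
  pose proof (Rmin_l (dist a b) (dist a' b')) as M1; pose proof (Rmin_r (dist a b) (dist a' b')) as M2.
  specialize (Hn n); exists n.
  assert (N1 : ~ (H (r n) a /\ H (r n) b)).
  { intros [h1 h2]; specialize (Hn a b (PeanoNat.Nat.le_refl _) h1 h2); lra. }
  assert (N2 : ~ (H (r n) a' /\ H (r n) b')).
  { intros [h1 h2]; specialize (Hn a' b' (PeanoNat.Nat.le_refl _) h1 h2); lra. }
  destruct (classic (fst (r n) = fst e)) as [E | I].
  - exfalso; destruct (same_index_edges _ _ E) as [Er | Er]; rewrite Er in *; auto.
  - destruct (lt_tetra (r n) e I) as [k | [k | [k | k]]]; auto; exfalso.
    + apply N2; split; apply (lt_sub (bar e)); auto; now apply lt_bar_l.
    + apply N1; split; apply (lt_sub e); auto.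
Qed.

Lemma chain_point_not_Dom r z e : (forall i, cov (r (S i)) (r i)) ->
  (forall i, H (r i) z) -> ~ Dom e z.
Proof.
  intros c Hz D; destruct (chain_eventually r e c) as (n & [k | k]).
  - apply (chain_point_interior r z n c Hz); now apply (lt_Dom e).
  - apply (k z (Hz n)); rewrite Cbar_involutive; now apply Dom_half.
Qed.

(** Some [r n] lies below [f]. Going back up the chain, [f] can be passed only by meeting it,
    because no edge lies strictly between [r (S n)] and [r n]. *)
Lemma chain_contains r z f : (forall i, cov (r (S i)) (r i)) -> (forall i, H (r i) z) ->
  H f z -> ~ H (bar f) z -> lt f (r 0%nat) -> exists i, f = r i.
Proof.
  intros c Hz Hf Nf k.
  assert (C : exists n, lt (r n) f).
  { destruct (chain_eventually r f c) as (n & [j | j]); eauto; exfalso.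
    apply (j z (Hz n)); now rewrite Cbar_involutive. }
  destruct C as [n Hn]; induction n as [| n IH]; [exfalso; exact (lt_asym _ _ k Hn) |].
  destruct (classic (fst f = fst (r n))) as [E | I].
  - destruct (same_index_edges _ _ E) as [Er | Er]; eauto; exfalso.
    subst f; apply (chain_point_interior r z n c Hz); auto.
  - destruct (lt_tetra f (r n) I) as [j | [j | [j | j]]]; auto; exfalso.
    + exact (proj2 (c n) f Hn j).
    + apply (j z Hf); rewrite Cbar_involutive; apply Hz.
    + apply (lt_both_sources f (r 0%nat) k); destruct n as [| n]; auto.
      apply (lt_trans _ (r (S n))); auto; apply chain_lt; auto; lia.
Qed.

(** A late edge of [r'] lies below [r 0] and its opposite halfspace misses [z], so it occurs in [r].
    From there on the two next edges are covered by the same edge and share [z], hence agree by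
    [covers_disjoint]. *)
Lemma chains_merge r r' z :
  (forall i, cov (r (S i)) (r i)) -> (forall i, cov (r' (S i)) (r' i)) ->
  (forall i, H (r i) z) -> (forall i, H (r' i) z) ->
  exists k m, forall n, r (n + k)%nat = r' (n + m)%nat.
Proof.
  intros c c' Hz Hz'.
  destruct (chain_eventually r' (r 0%nat) c') as (m & [k | k]).
  2: { exfalso; apply (k z (Hz' m)); rewrite Cbar_involutive; apply Hz. }
  destruct (chain_contains r z (r' m) c Hz (Hz' m)) as [i E]; auto.
  { now apply chain_point_interior. }
  exists i, m; intro n; induction n as [| n IH]; [now symmetry |].
  simpl; apply NNPP; intro N.
  assert (c1 : cov (r' (S (n + m))) (r (n + i)%nat)) by (rewrite IH; apply c').
  apply (covers_disjoint _ _ _ (c _) c1 N z); [apply Hz | rewrite Cbar_involutive; apply Hz'].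
Qed.

Lemma Dom_or_chain z : inhabited L -> (exists e, Dom e z) \/
  exists r, (forall i, cov (r (S i)) (r i)) /\ forall i, H (r i) z.
Proof.
  intros [m]; destruct (classic (exists e, Dom e z)) as [| N]; auto; right.
  (* A point of [H e] outside every domain lies in [H f] for some [f] covered by [e]. When [z] is
     outside [H e] the choice is a placeholder, never met when iterating from [e0]. *)
  assert (St : forall e, exists f, H e z -> cov f e /\ H f z).
  { intro e; destruct (classic (H e z)) as [He | He]; [| exists e; tauto].
    apply NNPP; intro N'; apply N; exists e; rewrite DomE; split; auto.
    intros f c; destruct (half_cover f z) as [Hf |]; auto.
    exfalso; apply N'; exists f; auto. }
  destruct (functional_choice _ St) as [s Hs].
  assert (E0 : exists e, H e z).
  { destruct (half_cover (m, true) z); eauto. }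
  destruct E0 as [e0 H0]; exists (fun n => Nat.iter n s e0).
  assert (Hz : forall i, H (Nat.iter i s e0) z).
  { induction i as [| i IH]; auto; apply Hs; exact IH. }
  split; auto; intro i; apply Hs, Hz.
Qed.

(** Both halfspaces of a splitting have positive diameter, so each index occurs in one of the finite
    lists that fineness gives for the bounds [/ INR (S n)]. *)
Lemma index_enumeration : exists ls : nat -> list L, forall l, exists n, In l (ls n).
Proof.
  assert (C : forall n, exists ls, forall l,
    diam_gt dist (Y l) (/ INR (S n)) /\ diam_gt dist (Z l) (/ INR (S n)) -> In l ls).
  { intro n; apply HF, Rinv_0_lt_compat, lt_0_INR; lia. }
  destruct (functional_choice _ C) as [ls Hls]; exists ls; intro l.
  destruct (Dom_two_points (l, true)) as (a & b & Ha & Hb & Hab).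
  destruct (Dom_two_points (l, false)) as (a' & b' & Ha' & Hb' & Hab').
  apply Dom_half in Ha, Hb, Ha', Hb'.
  destruct (archimed_cor1 (Rmin (dist a b) (dist a' b'))) as (n & Hn & Hp).
  { now apply Rmin_pos. }
  pose proof (Rmin_l (dist a b) (dist a' b')) as M1; pose proof (Rmin_r (dist a b) (dist a' b')) as M2.
  exists (pred n); apply Hls; rewrite (PeanoNat.Nat.succ_pred_pos n Hp).
  split; [exists a, b | exists a', b']; repeat split; auto; lra.
Qed.

(** * The dual tree *)

Notation om := (Com A Y Z).
Notation al := (Cal A Y Z).
Notation dom := (@proj1_sig (X -> Prop) _).
Notation path := (rpath al om (@Cbar L)).

Lemma CV_ext (u v : CV A Y Z) : (forall x, dom u x <-> dom v x) -> u = v.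
Proof.
  destruct u as [D p], v as [D' p']; simpl; intro E.
  assert (ED : D = D').
  { apply functional_extensionality; intro x; apply propositional_extensionality, E. }
  subst D'; f_equal; apply proof_irrelevance.
Qed.

Lemma CV_om (v : CV A Y Z) : exists e, v = om e.
Proof. destruct v as [D [e E]]; exists e; apply CV_ext; simpl; rewrite E; tauto. Qed.

Lemma om_bar e : om (bar e) = al e.
Proof. reflexivity. Qed.

Lemma al_bar e : al (bar e) = om e.
Proof. unfold Cal; now rewrite Cbar_involutive. Qed.

Lemma om_eq e f : om e = om f -> same_vertex e f.
Proof.
  intro E; apply Dom_eq_same_vertex; intro x.
  change (dom (om e) x <-> dom (om f) x); rewrite E; tauto.
Qed.

Lemma same_vertex_om e f : same_vertex e f -> om e = om f.
Proof.
  intro S; apply CV_ext; intro x; split; apply same_vertex_Dom; auto.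
  now apply same_vertex_sym.
Qed.

Lemma cov_om e f : cov f e -> om e = al f.
Proof. intro c; apply same_vertex_om; right; now rewrite Cbar_involutive. Qed.

Lemma om_cov e f : om e = al f -> f <> bar e -> cov f e.
Proof.
  intros E N; destruct (om_eq _ _ E) as [-> | c].
  - exfalso; apply N; now rewrite Cbar_involutive.
  - now rewrite Cbar_involutive in c.
Qed.

Lemma star_disjoint e f : al e = al f -> e <> f -> lt e (bar f).
Proof.
  intros E N; destruct (om_eq _ _ E) as [E' | c].
  - exfalso; apply N; rewrite <- (Cbar_involutive e), E'; apply Cbar_involutive.
  - rewrite Cbar_involutive in c; now apply lt_bar_r, (proj1 c).
Qed.

Lemma dom_om e x : dom (om e) x -> H e x.
Proof. apply Dom_half. Qed.

Lemma dom_al e x : dom (al e) x -> H (bar e) x.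
Proof. apply Dom_half. Qed.

Lemma separator_om e x : A (fst e) x -> dom (om e) x.
Proof. apply separator_Dom. Qed.

Lemma separator_al e x : A (fst e) x -> dom (al e) x.
Proof. exact (separator_Dom (bar e) x). Qed.

Lemma dom_nonempty (v : CV A Y Z) : exists x, dom v x.
Proof.
  destruct (CV_om v) as [e ->]; destruct (separator_nonempty (fst e)) as [x Hx].
  exists x; now apply separator_om.
Qed.

(** Such a domain would lie in the separator of [e], which by disjointness is then also the
    separator of an edge ending at [v]; but the domain exceeds that separator. *)
Lemma dom_one_side (v : CV A Y Z) e :
  incl_set (dom v) (H e) -> incl_set (dom v) (H (bar e)) -> False.
Proof.
  intros H1 H2.
  assert (S : forall x, dom v x -> A (fst e) x) by (intros x Hx; apply half_inter; auto).
  destruct (CV_om v) as [f ->].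
  destruct (separator_nonempty (fst f)) as [a Ha].
  destruct (Dom_not_separator f) as (x & Hx & Hn).
  apply Hn; rewrite (separators_disjoint (fst f) (fst e) a Ha); [now apply S |].
  apply S; now apply separator_om.
Qed.

Lemma loopless e : al e <> om e.
Proof.
  intro E; apply (dom_one_side (om e) e).
  - intro; apply dom_om.
  - rewrite <- E; intro; apply dom_al.
Qed.

(** By [om_cov], each edge of a reduced path covers the next, so the halfspaces decrease along
    it. *)
Lemma path_sub q e v : path (om e) v (Some e) q -> incl_set (dom v) (H e).
Proof.
  revert e; induction q as [| f q IH]; intros e P.
  - simpl in P; subst v; intro; apply dom_om.
  - destruct P as (E & N & P).
    intros x Hx; apply (lt_sub f); [apply om_cov; auto | exact (IH f P x Hx)].
Qed.

Lemma path_sub_strict f q e v x :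
  path (om e) v (Some e) (f :: q) -> dom v x -> ~ H (bar e) x.
Proof.
  intros (E & N & P) Hx; apply (proj1 (om_cov e f (eq_sym E) N)).
  exact (path_sub q f v P x Hx).
Qed.

Lemma path_weaken u v o p : path u v o p -> path u v None p.
Proof. destruct p; simpl; tauto. Qed.

(** Two paths to [v] with different first edges would put the nonempty domain of [v] into two
    disjoint halfspaces; a nonempty closed path is excluded by [dom_one_side]. *)
Lemma path_unique u v o p p' : path u v o p -> path u v o p' -> p' = p.
Proof.
  assert (C : forall e q o, path (al e) (al e) o (e :: q) -> False).
  { intros e q o1 (_ & _ & P); apply (dom_one_side (al e) e); [exact (path_sub _ _ _ P) |].
    intro; apply dom_al. }
  revert u o p'; induction p as [| e p IH]; intros u o [| e' p'] P P'; auto.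
  - simpl in P; subst v; exfalso; destruct (P') as (<- & _); exact (C _ _ _ P').
  - simpl in P'; subst v; exfalso; destruct (P) as (<- & _); exact (C _ _ _ P).
  - destruct P as (E & N & P), P' as (E' & N' & P').
    assert (e = e').
    { apply NNPP; intro Ne; destruct (dom_nonempty v) as [x Hx].
      apply (star_disjoint e e' (eq_trans E (eq_sym E')) Ne x).
      - exact (path_sub _ _ _ P x Hx).
      - rewrite Cbar_involutive; exact (path_sub _ _ _ P' x Hx). }
    subst e'; f_equal; eapply IH; eauto.
Qed.

(** * Connectedness and countability of the dual tree *)

Definition reach (u v : CV A Y Z) : Prop := exists p, path u v None p.

Lemma reach_step g v : reach (om g) v -> reach (al g) v.
Proof.
  intros [[| f p] P].
  - exists (g :: nil); simpl in *; auto.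
  - destruct (classic (f = bar g)) as [-> | N].
    + exists p; apply (path_weaken _ _ (Some (bar g))), P.
    + exists (g :: f :: p); simpl in *; intuition.
Qed.

Lemma reach_trans u w v : reach u w -> reach w v -> reach u v.
Proof.
  intros [p P] Q; revert u P; induction p as [| e p IH]; intros u P.
  - simpl in P; now subst w.
  - destruct P as (<- & _ & P); apply reach_step, IH.
    exact (path_weaken _ _ _ _ P).
Qed.

Lemma reach_refl u : reach u u.
Proof. exists nil; reflexivity. Qed.

Lemma reach_edge e : reach (al e) (om e) /\ reach (om e) (al e).
Proof.
  split; [apply reach_step, reach_refl |].
  rewrite <- al_bar; apply reach_step, reach_refl.
Qed.

Lemma reach_lt f e : lt f e -> reach (om e) (om f) /\ reach (om f) (om e).
Proof.
  revert f e; apply interval_ind.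
  - intros f e c; rewrite (cov_om e f c); apply reach_edge.
  - intros f g e _ _ [] []; split; eapply reach_trans; eauto.
Qed.

Lemma reach_all u v : reach u v.
Proof.
  destruct (CV_om u) as [e ->], (CV_om v) as [f ->].
  pose proof (reach_edge e) as [E1 E2]; pose proof (reach_edge f) as [F1 F2].
  rewrite <- om_bar in E1, E2, F1, F2.
  destruct (classic (fst e = fst f)) as [E | I].
  - destruct (same_index_edges _ _ E) as [-> | ->]; [apply reach_refl | auto].
  - destruct (lt_tetra e f I) as [k | [k | [k | k]]]; apply reach_lt in k; destruct k;
      eauto using reach_trans.
Qed.

Notation Th := (ThetaC dist A Y Z).

(** For the converse, a path from [om e] to [t] starting with [bar e] would put the domain of [t]
    into [H (bar e)] as well. *)
Lemma beyond_iff e t : @beyond Th e t <-> incl_set (dom t) (H e).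
Proof.
  split; [intros [q P]; exact (path_sub _ _ _ P) |].
  intro S; destruct (reach_all (om e) t) as [[| f p] P].
  - exists nil; exact P.
  - exists (f :: p); destruct P as (E & _ & P); repeat split; auto.
    intros ->; exact (dom_one_side t e S (path_sub _ _ _ P)).
Qed.

Lemma CV_countable : exists f : CV A Y Z -> nat, forall u v, f u = f v -> u = v.
Proof.
  destruct index_enumeration as [ls Hls].
  (* The code of [v] records where an edge ending at [v] stands in the enumeration: the list, the
     position in it, and the side. *)
  assert (C : forall v : CV A Y Z, exists k, exists n i b l,
    k = to_nat (n, to_nat (i, Nat.b2n b)) /\ nth_error (ls n) i = Some l /\ v = om (l, b)).
  { intro v; destruct (CV_om v) as [[l b] E]; destruct (Hls l) as [n Hn].
    destruct (In_nth_error _ _ Hn) as [i Hi]; eauto 10. }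
  destruct (functional_choice _ C) as [f Hf]; exists f; intros u v E.
  destruct (Hf u) as (n & i & b & l & E1 & E2 & ->).
  destruct (Hf v) as (n' & i' & b' & l' & E1' & E2' & ->).
  assert (J : forall x y, to_nat x = to_nat y -> x = y).
  { intros x y Exy; rewrite <- (cancel_of_to x), <- (cancel_of_to y); now f_equal. }
  rewrite E1, E1' in E; apply J in E; apply pair_equal_spec in E; destruct E as [En E].
  apply J in E; apply pair_equal_spec in E; destruct E as [Ei Eb]; subst n' i'.
  rewrite E2 in E2'; injection E2' as ->.
  destruct b, b'; simpl in Eb; congruence.
Qed.

Lemma dual_tree : is_countable_tree al om (@Cbar L).
Proof.
  split; [apply Cbar_involutive |]; split; [apply Cbar_neq |]; split; [apply al_bar |].
  split; [| exact CV_countable].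
  intros u v; destruct (reach_all u v) as [p P]; exists p; split; auto.
  intros p' P'; exact (path_unique _ _ _ _ _ P P').
Qed.

(** * The axioms of a tree system *)

Lemma slice_compact (S : X -> Prop) (v : CV A Y Z) : compact_sub dist S ->
  compact_sub (@tsd Th) (fun p : CV A Y Z * X => fst p = v /\ S (snd p)).
Proof.
  intros HS J U HU Hc.
  destruct (HS J (fun i x => U i (v, x))) as [l Hl].
  - intros i x Sx Ux; destruct (HU i (v, x) (conj eq_refl Sx) Ux) as (eps & He & Hy).
    exists eps; split; auto; intros y Sy D; apply Hy; auto; split; auto.
  - intros x Sx; apply Hc; split; auto.
  - exists l; intros [w x] [E Sx]; simpl in *; subst w; auto.
Qed.

Lemma slice_metric (S : CV A Y Z * X -> Prop) (v : CV A Y Z) :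
  (forall p, S p -> fst p = v) -> is_metric_on (@tsd Th) S.
Proof.
  intro E; destruct Hm as (m1 & m2 & m3 & m4); split; [| split; [| split]]; simpl; auto.
  intros [u x] [w y] Sx Sy; pose proof (E _ Sx); pose proof (E _ Sy); simpl in *; subst u w.
  rewrite m2 by auto; split; congruence.
Qed.

Lemma separator_compact l : compact_sub dist (A l).
Proof. destruct HT as [HE _]; exact (proj1 (HE l)). Qed.

Theorem ThetaC_tree_system : tree_system_mc Th.
Proof.
  split; [exact dual_tree |]; split; [| split; [| split]].
  - intro t; split; [apply (slice_metric _ t); now intros p [] |].
    intros J U HU Hc.
    destruct (slice_compact (dom t) t) with (I := J) (U := U) as [l Hl].
    + destruct (CV_om t) as [e ->]; apply Dom_compact.
    + intros i [w x] [E Hx] Ux; simpl in E; subst w.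
      destruct (HU i (t, x)) as (eps & He & Hy); auto; [split; auto |].
      exists eps; split; auto; intros [w y] [E Hy'] D; simpl in E; subst w.
      apply Hy; auto; split; auto.
    + intros [w x] [E Hx]; simpl in E; subst w; apply Hc; split; auto.
    + exists l; intros [w x] [E Hx]; simpl in E; subst w; apply Hl; split; auto.
  - intro e; split; [| split].
    + intros [w x] [E Hx]; simpl in *; subst w; split; auto; now apply separator_al.
    + destruct (separator_nonempty (fst e)) as [x Hx]; exists (al e, x); split; auto.
    + apply (slice_compact (A (fst e)) (al e)), separator_compact.
  - intro e; split; [| split].
    + intros [w x] [E Hx]; split; simpl in *; auto; symmetry; apply al_bar.
    + intros [w x] [E Hx]; simpl in *; now subst w.
    + intros p Hp eps He; exists eps; split; auto.
  - intro t; split.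
    + intros eps He; apply finitely_many_sub with
        (Q := fun e => diam_gt dist (H e) (eps / 2) /\ diam_gt dist (H (bar e)) (eps / 2)).
      2: { apply fine_edges; lra. }
      intros e [_ D]; destruct (D (eps / 2)) as (p & q & [_ Hp] & [_ Hq] & Hd); [lra |].
      split; exists (snd p), (snd q); repeat split; auto;
        now apply separator_half || now apply separator_half_bar.
    + intros e e' E E' N p [[_ Hp] [_ Hp']].
      pose proof (separators_disjoint _ _ _ Hp Hp') as I.
      destruct (same_index_edges _ _ I) as [-> | ->]; [contradiction |].
      apply (loopless e'); rewrite <- al_bar; exact (eq_trans E' (eq_sym E)).
Qed.

(** * The homeomorphism *)

Lemma dom_side (t : CV A Y Z) e : incl_set (dom t) (H e) \/ incl_set (dom t) (H (bar e)).
Proof.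
  destruct (CV_om t) as [f ->].
  destruct (classic (fst f = fst e)) as [E | I].
  - destruct (same_index_edges _ _ E) as [-> | ->]; [left | right]; intro; apply dom_om.
  - destruct (lt_tetra f e I) as [k | [k | [k | k]]].
    + left; intros x Hx; apply (lt_sub f); auto using dom_om.
    + right; intros x Hx; apply (lt_sub f); auto using dom_om.
    + left; intros x Hx; rewrite <- (Cbar_involutive e); apply (lt_Dom f); auto.
      now apply lt_bar_l.
    + right; intros x Hx; now apply (lt_Dom f).
Qed.

Lemma ray_chain r : @is_ray Th r <-> forall n, cov (r (S n)) (r n).
Proof.
  split; intros Hr n.
  - destruct (Hr n) as [E N]; exact (om_cov _ _ E N).
  - split; [exact (cov_om _ _ (Hr n)) |].
    intro E; apply (lt_index _ _ (proj1 (Hr n))); rewrite E; reflexivity.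
Qed.

Lemma chain_beyond r e N n : (forall i, cov (r (S i)) (r i)) -> lt (r N) e ->
  (N < n)%nat -> incl_set (dom (al (r n))) (H e).
Proof.
  intros c k l x Hx; destruct n as [| n]; [lia |].
  rewrite <- (cov_om _ _ (c n)) in Hx; apply dom_om in Hx.
  apply (lt_sub (r N)); auto; apply (chain_sub r N n); auto; lia.
Qed.

Lemma beyond_chain r e m : (forall i, cov (r (S i)) (r i)) ->
  (forall n, (m <= n)%nat -> @beyond Th e (al (r n))) -> exists N, lt (r N) e.
Proof.
  intros c Hb; destruct (chain_eventually r e c) as [N [k | k]]; eauto; exfalso.
  apply (dom_one_side (al (r (m + S N)%nat)) e).
  - apply beyond_iff, Hb; lia.
  - apply (chain_beyond r (bar e) N); auto; lia.
Qed.

(** [epsilon] gives a total function. On rays its value is determined, by [chain_point] and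
    [chain_point_unique]; nothing is claimed for other sequences. *)
Definition lim_map (i : inhabited X) (x : LimPt Th) : X :=
  match x with
  | LPt p => snd p
  | LEnd r => epsilon i (fun z => forall n, H (r n) z)
  end.

Lemma lim_map_end i r n : @is_ray Th r -> H (r n) (lim_map i (LEnd r)).
Proof.
  intro Hr; revert n; simpl.
  apply (epsilon_spec i (fun z => forall n, H (r n) z)), chain_point; now apply ray_chain.
Qed.

Lemma lim_map_end_unique i r y : @is_ray Th r ->
  (forall n, H (r n) y) <-> y = lim_map i (LEnd r).
Proof.
  intro Hr; split; [| intros -> n; now apply lim_map_end].
  intro Hy; apply (chain_point_unique r); auto; [now apply ray_chain |].
  intro n; now apply lim_map_end.
Qed.

(** * Bijectivity of the limit map *)

Lemma shared_path u v x p : path u v None p -> dom u x -> dom v x ->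
  p = nil \/ exists e, p = e :: nil /\ A (fst e) x.
Proof.
  intros P Hu Hv; destruct p as [| e [| f q]]; auto; right.
  - destruct P as (<- & _ & P); exists e; split; auto; apply half_inter; split.
    + exact (path_sub _ _ _ P x Hv).
    + now apply dom_al.
  (* With two or more edges, [x] would lie off the halfspace opposite to the first edge, although
     the domain where the path starts is contained in it. *)
  - destruct P as (<- & _ & P); exfalso.
    apply (path_sub_strict _ _ _ _ x P Hv); now apply dom_al.
Qed.

Lemma shared_point u v x : dom u x -> dom v x ->
  u = v \/ exists e, al e = u /\ om e = v /\ A (fst e) x.
Proof.
  intros Hu Hv; destruct (reach_all u v) as [p P].
  destruct (shared_path _ _ x _ P Hu Hv) as [-> | (e & -> & Ha)]; [now left |].
  right; exists e; destruct P as (E & _ & P); auto.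
Qed.

Lemma glued_points (p q : CV A Y Z * X) : dom (fst p) (snd p) -> dom (fst q) (snd q) ->
  (snd p = snd q <-> clos_refl_sym_trans _ (@glue Th) p q).
Proof.
  intros Hp Hq; split.
  - destruct p as [u x], q as [v y]; simpl in *; intros ->.
    destruct (shared_point u v y Hp Hq) as [-> | (e & <- & <- & Ha)]; [apply rst_refl |].
    apply rst_step; exists e; repeat split; auto.
  - clear Hp Hq; induction 1 as [p q (e & _ & ->) | | |]; [reflexivity | congruence ..].
Qed.

Lemma lim_map_injective i x y : lim_valid x -> lim_valid y ->
  (lim_map i x = lim_map i y <-> lim_rel x y).
Proof.
  assert (C : forall (p : CV A Y Z * X) r, dom (fst p) (snd p) -> @is_ray Th r ->
    snd p <> lim_map i (LEnd r)).
  { intros [v z] r Hp Hr E; simpl in Hp; destruct (CV_om v) as [e ->].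
    apply (chain_point_not_Dom r z e); auto; [now apply ray_chain |].
    now apply (lim_map_end_unique i). }
  destruct x as [p | r], y as [q | r']; intros Vx Vy.
  - apply glued_points; auto.
  - split; [intro E; exact (C p r' Vx Vy E) | intros []].
  - split; [intro E; exact (C q r Vy Vx (eq_sym E)) | intros []].
  - split.
    + intro E; apply (chains_merge r r' (lim_map i (LEnd r))); try now apply ray_chain.
      * intro n; now apply lim_map_end.
      * intro n; rewrite E; now apply lim_map_end.
    + intros (k & m & E); apply (lim_map_end_unique i); auto.
      intro n; apply (chain_sub r' n (n + m)); [exact (proj1 (ray_chain r') Vy) | lia |].
      rewrite <- E; now apply lim_map_end.
Qed.

Lemma lim_map_surjective i z : inhabited L -> exists x, lim_valid x /\ lim_map i x = z.
Proof.
  intro HL; destruct (Dom_or_chain z HL) as [[e D] | (r & c & Hz)].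
  - exists (@LPt Th (om e, z)); split; auto.
  - apply ray_chain in c; exists (@LEnd Th r); split; auto.
    symmetry; now apply lim_map_end_unique.
Qed.

(** * Finite subtrees and the halfspaces leaving them *)

Section Subtree.

Context {F : CV A Y Z -> Prop}.
Hypothesis HFs : @finite_subtree Th F.

Notation NFe := (@NF Th F).

(** By convexity the path from [al e] to [t] stays in [F], so its first edge differs from [e], which
    leaves [F]. *)
Lemma subtree_side t e : F t -> NFe e -> incl_set (dom t) (H (bar e)).
Proof.
  intros Ft [Fa Fo]; destruct HFs as (_ & _ & Hconv); destruct (reach_all (al e) t) as [p P].
  specialize (Hconv _ _ _ Fa Ft P); destruct p as [| f q].
  - simpl in P; subst t; intro; apply dom_al.
  - destruct P as (E & _ & P).
    assert (N : f <> e) by (intros ->; apply Fo, Hconv; simpl; auto).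
    intros x Hx; apply (lt_sub f); [now apply star_disjoint | exact (path_sub _ _ _ P x Hx)].
Qed.

Lemma subtree_exit t : ~ F t -> exists e, NFe e /\ incl_set (dom t) (H e).
Proof.
  intro Nt; destruct HFs as (_ & [u Fu] & _); destruct (reach_all u t) as [p P].
  revert P; generalize (@None (L * bool)) as o; revert u Fu.
  induction p as [| e p IH]; intros u Fu o P; [simpl in P; now subst |].
  destruct P as (<- & _ & P).
  destruct (classic (F (om e))) as [Fo | Fo]; [exact (IH _ Fo _ P) |].
  exists e; split; [split; auto | exact (path_sub _ _ _ P)].
Qed.

(** The halfspaces opposite to outer edges all contain the domain of one vertex of [F], so their
    diameters stay above [dl] and fineness applies to the outer ones. *)
Lemma NF_null eps : 0 < eps -> finitely_many (fun e => NFe e /\ diam_gt dist (H e) eps).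
Proof.
  intro He; destruct HFs as (_ & [t Ft] & _).
  destruct (CV_om t) as [f Ef]; destruct (Dom_two_points f) as (a & b & Ha & Hb & Hab).
  set (dl := Rmin eps (dist a b) / 2).
  assert (Hd : 0 < Rmin eps (dist a b)) by now apply Rmin_pos.
  pose proof (Rmin_l eps (dist a b)) as M1; pose proof (Rmin_r eps (dist a b)) as M2.
  apply finitely_many_sub with
    (Q := fun e => diam_gt dist (H e) dl /\ diam_gt dist (H (bar e)) dl).
  2: { apply fine_edges; unfold dl; lra. }
  intros e [N D]; split.
  - revert D; apply diam_gt_mono; [intro; auto | unfold dl; lra].
  - exists a, b; split; [| split; [| unfold dl; lra]];
      apply (subtree_side t); subst t; auto.
Qed.

(* The members of the null family [H e] that are not small are finitely many and are avoided
   one by one; the small ones lie close to a point that is far from [z]. *)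
Lemma avoid_outer_halves (C : L * bool -> Prop) z eps0 : 0 < eps0 ->
  (forall e, C e -> NFe e /\ ~ H e z /\ exists w, H e w /\ eps0 <= dist z w) ->
  exists eps, 0 < eps /\ forall e y, C e -> dist z y < eps -> ~ H e y.
Proof.
  intros H0 HC; destruct (NF_null (eps0 / 2)) as [l Hl]; [lra |].
  destruct (avoid_finite Hm H z l half_compact) as (m & Hp & Hav).
  exists (Rmin m (eps0 / 2)); split; [apply Rmin_pos; lra |].
  intros e y Ce D Hy; destruct (HC e Ce) as (N & Nz & w & Hw & Dw).
  pose proof (Rmin_l m (eps0 / 2)) as M1; pose proof (Rmin_r m (eps0 / 2)) as M2.
  apply (Hav e y); auto; [| lra].
  apply Hl; split; auto; exists y, w; repeat split; auto.
  pose proof (dist_triangle Hm z y w); lra.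
Qed.

Lemma avoid_domains z : exists eps, 0 < eps /\
  forall t y, F t -> ~ dom t z -> dist z y < eps -> ~ dom t y.
Proof.
  destruct HFs as ([l Hl] & _).
  destruct (avoid_finite Hm (fun t : CV A Y Z => dom t) z l) as (m & Hp & Hav).
  - intro t; destruct (CV_om t) as [e ->]; apply Dom_compact.
  - exists m; split; auto; intros t y Ft; apply Hav; auto.
Qed.

(** The domains of [F] and the outer halfspaces together form a closed set, since a point outside
    has a ball missing them all. It is also dense: it contains every domain, and [chain_small] finds
    domains near the point of any chain. *)
Lemma subtree_or_outer_half y : inhabited L ->
  (exists t, F t /\ dom t y) \/ exists e, NFe e /\ H e y.
Proof.
  intro HL; apply NNPP; intro N.
  assert (N1 : forall t, F t -> ~ dom t y) by (intros t Ft Hy; apply N; left; eauto).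
  assert (N2 : forall e, NFe e -> ~ H e y) by (intros e Ne Hy; apply N; right; eauto).
  destruct (avoid_domains y) as (eps0 & H0 & Hd).
  destruct (avoid_outer_halves NFe y eps0 H0) as (eps1 & H1 & He).
  { intros e Ne; split; [| split]; auto.
    destruct (separator_nonempty (fst e)) as [a Ha]; exists a; split.
    - now apply separator_half.
    - destruct (Rle_lt_dec eps0 (dist y a)) as [| D]; auto; exfalso.
      apply (Hd (al e) a); auto; [apply Ne | apply N1, Ne | now apply separator_al]. }
  assert (C : exists (t : CV A Y Z) x, dom t x /\ dist y x < Rmin eps0 eps1).
  { destruct (Dom_or_chain y HL) as [[f D] | (r & c & Hr)].
    - exists (om f), y; split; auto; rewrite (dist_self Hm); now apply Rmin_pos.
    - destruct (chain_small r (Rmin eps0 eps1) c) as [n Hn]; [now apply Rmin_pos |].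
      destruct (dom_nonempty (om (r n))) as [x Hx]; exists (om (r n)), x; split; auto.
      apply (Hn n); auto; now apply dom_om. }
  destruct C as (t & x & Hx & Dx).
  pose proof (Rmin_l eps0 eps1) as M1; pose proof (Rmin_r eps0 eps1) as M2.
  destruct (classic (F t)) as [Ft | Ft].
  - apply (Hd t x); auto; lra.
  - destruct (subtree_exit t Ft) as (e & Ne & S); apply (He e x); auto; lra.
Qed.

(** * Openness of the images of basic sets *)

Context {U : CV A Y Z * X -> Prop}.
Hypothesis HU : @admissible Th F U.

Notation G := (@Gset Th F U).

(** A gluing map relates adjacent vertices only, but by [shared_point] two vertices with a common
    point are equal or adjacent. *)
Lemma admissible_saturated s t z : U (s, z) -> F t -> dom t z -> U (t, z).
Proof.
  intros Us Ft Hz; destruct HU as (U1 & U2 & _).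
  destruct (U1 _ Us) as [Fs Hs]; simpl in Fs, Hs.
  destruct (shared_point s t z Hs Hz) as [<- | (e & <- & <- & Ha)]; auto.
  apply (U2 e (al e, z)); auto; split; auto.
Qed.

Lemma admissible_ball s z : U (s, z) -> exists eps, 0 < eps /\
  forall t y, F t -> dom t y -> dist z y < eps -> U (t, y).
Proof.
  intro Us.
  destruct (avoid_domains z) as (eps0 & H0 & Hd).
  assert (C : forall l : list (CV A Y Z), exists eps, 0 < eps /\
    forall t y, In t l -> F t -> dom t z -> dom t y -> dist z y < eps -> U (t, y)).
  { induction l as [| a l (eps & He & IH)]; [exists 1; split; [lra | intros t y []] |].
    destruct (classic (U (a, z))) as [Ua | Na].
    - destruct HU as (_ & _ & U3 & _); destruct (U3 _ Ua) as (eps' & He' & Hy').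
      exists (Rmin eps eps'); split; [now apply Rmin_pos |].
      pose proof (Rmin_l eps eps') as M1; pose proof (Rmin_r eps eps') as M2.
      intros t y [<- | Ht] Ft Hz Hy D; [| apply IH; auto; lra].
      apply Hy'; [split; auto | simpl; lra].
    - exists eps; split; auto; intros t y [<- | Ht] Ft Hz Hy D; [| apply IH; auto].
      exfalso; apply Na; exact (admissible_saturated s a z Us Ft Hz). }
  destruct HFs as ([l Hl] & _); destruct (C l) as (eps1 & H1 & Hl1).
  exists (Rmin eps0 eps1); split; [now apply Rmin_pos |].
  pose proof (Rmin_l eps0 eps1) as M1; pose proof (Rmin_r eps0 eps1) as M2.
  intros t y Ft Hy D; apply Hl1; auto; [| lra].
  apply NNPP; intro Nz; apply (Hd t y); auto; lra.
Qed.

(** Domains of vertices of [F] lie in [H (bar e)], so a vertex whose domain contains [y] is outside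
    [F] and, by [dom_side], beyond [e]; a chain closing in on [y] eventually passes below [e]. *)
Lemma Gset_outer_half i e y : inhabited L -> NFe e -> incl_set (tsSig Th e) U ->
  H e y -> ~ H (bar e) y -> exists x, G x /\ lim_map i x = y.
Proof.
  intros HL Ne HS Hy Ny; destruct (Dom_or_chain y HL) as [[f D] | (r & c & Hr)].
  - exists (@LPt Th (om f, y)); split; [| reflexivity]; split; [exact D |].
    assert (N : ~ incl_set (dom (om f)) (H (bar e))) by (intro K; exact (Ny (K y D))).
    right; exists e; split; [| split; [| split]]; auto.
    + intro Ft; apply N; now apply subtree_side.
    + apply beyond_iff; destruct (dom_side (om f) e); [assumption | contradiction].
  - destruct (chain_eventually r e c) as (n & [k | k]).
    2: { exfalso; apply Ny; exact (lt_sub _ _ _ k (Hr n)). }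
    exists (@LEnd Th r); assert (Rr : @is_ray Th r) by now apply ray_chain.
    split; [| symmetry; now apply lim_map_end_unique].
    split; auto; exists e; split; [| split]; auto; exists (S n); intros m Hmn.
    apply beyond_iff, (chain_beyond r e n); auto.
Qed.

Lemma Gset_near_core i s z : inhabited L -> U (s, z) ->
  exists eps, 0 < eps /\ forall y, dist z y < eps -> exists x, G x /\ lim_map i x = y.
Proof.
  intros HL Us; destruct (admissible_ball s z Us) as (eps0 & H0 & HUb).
  destruct (HU) as (U1 & _ & _ & U4).
  (* Outer halfspaces whose separators miss [U] must be kept away from [z]. Their separators are at
     distance at least [eps0] from [z], which supplies the far points that [avoid_outer_halves]
     requires. *)
  destruct (avoid_outer_halves (fun e => NFe e /\ forall p, tsSig Th e p -> ~ U p) z eps0 H0)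
    as (eps1 & H1 & He).
  { intros e [Ne Nu]; split; [| split]; auto.
    - intro Hz; destruct (U1 _ Us) as [Fs Hs].
      assert (Ha : A (fst e) z).
      { apply half_inter; split; auto; exact (subtree_side s e Fs Ne z Hs). }
      apply (Nu (al e, z)); [split; auto |].
      apply (admissible_saturated s); auto; [apply Ne | now apply separator_al].
    - destruct (separator_nonempty (fst e)) as [a Ha]; exists a.
      split; [now apply separator_half |].
      destruct (Rle_lt_dec eps0 (dist z a)) as [| D]; auto; exfalso.
      apply (Nu (al e, a)); [split; auto |].
      apply HUb; auto; [apply Ne | now apply separator_al]. }
  exists (Rmin eps0 eps1); split; [now apply Rmin_pos |].
  pose proof (Rmin_l eps0 eps1) as M1; pose proof (Rmin_r eps0 eps1) as M2.
  intros y D.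
  assert (K : (exists t, F t /\ dom t y) -> exists x, G x /\ lim_map i x = y).
  { intros (t & Ft & Hy); exists (@LPt Th (t, y)); split; [| reflexivity].
    split; [exact Hy | left; apply HUb; auto; lra]. }
  destruct (subtree_or_outer_half y HL) as [C | (e & Ne & Hy)]; auto.
  destruct (classic (H (bar e) y)) as [Hb | Hb].
  - apply K; exists (al e); split; [apply Ne |].
    apply separator_al, half_inter; auto.
  - apply (Gset_outer_half i e); auto.
    destruct (U4 e Ne) as [| Nu]; auto; exfalso; apply (He e y); auto; lra.
Qed.

Lemma Gset_image_open i x : inhabited L -> G x ->
  exists eps, 0 < eps /\ forall y, dist (lim_map i x) y < eps -> exists x', G x' /\ lim_map i x' = y.
Proof.
  intros HL Gx.
  (* On the separator of [e] this is the case of a point of [U]; off it, a ball missing [H (bar e)]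
     lies in [H e]. *)
  assert (K : forall e z, NFe e -> incl_set (tsSig Th e) U -> H e z ->
    exists eps, 0 < eps /\ forall y, dist z y < eps -> exists x', G x' /\ lim_map i x' = y).
  { intros e z Ne HS Hz; destruct (classic (H (bar e) z)) as [Hb | Hb].
    - apply (Gset_near_core i (al e)); auto; apply HS; split; auto; now apply half_inter.
    - destruct (compact_avoid Hm _ _ (half_compact (bar e)) Hb) as (eps & He & Hy).
      exists eps; split; auto; intros y D; apply (Gset_outer_half i e); auto.
      destruct (half_cover e y) as [| Hyb]; auto; exfalso; exact (Hy y D Hyb). }
  destruct x as [[t z] | r]; destruct Gx as [V Gx]; simpl in V.
  - destruct Gx as [Us | (e & Ne & HS & _ & B)].
    + exact (Gset_near_core i t z HL Us).
    + apply (K e z); auto; exact (proj1 (beyond_iff e t) B z V).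
  - destruct Gx as (e & Ne & HS & n & B); apply (K e); auto.
    destruct (beyond_chain r e n) as [N k]; [now apply ray_chain | exact B |].
    apply (lt_sub (r N)); auto; now apply lim_map_end.
Qed.

End Subtree.

Lemma Gset_sub F U i (B : X -> Prop) x : @finite_subtree Th F ->
  (forall p : CV A Y Z * X, U p -> B (snd p)) ->
  (forall e, @NF Th F e -> incl_set (tsSig Th e) U -> incl_set (H e) B) ->
  @Gset Th F U x -> lim_valid x /\ B (lim_map i x).
Proof.
  intros Fs HU HN Gx; destruct x as [[t z] | r]; destruct Gx as [V Gx]; split; auto.
  - destruct Gx as [Us | (e & Ne & HS & _ & Be)]; [exact (HU _ Us) |].
    apply (HN e Ne HS); exact (proj1 (beyond_iff e t) Be z V).
  - destruct Gx as (e & Ne & HS & n & Be).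
    destruct (beyond_chain r e n) as [N k]; [now apply ray_chain | exact Be |].
    apply (HN e Ne HS), (lt_sub (r N)); auto; now apply lim_map_end.
Qed.

Lemma lim_map_open i W : inhabited L -> @lim_open Th W ->
  metric_open dist (fun z => exists x, W x /\ lim_map i x = z).
Proof.
  intros HL HW z (x & Wx & <-).
  destruct (HW x Wx) as (F & U & HFs & HU & Gx & HG).
  destruct (Gset_image_open HFs HU i x HL Gx) as (eps & He & Hy).
  exists eps; split; auto; intros y D; destruct (Hy y D) as (x' & Gx' & E); eauto.
Qed.

(** * Continuity of the limit map *)

Lemma shared_subtree z (t : CV A Y Z) : dom t z -> @finite_subtree Th (fun s : CV A Y Z => dom s z).
Proof.
  intro Hz; split; [| split; [exists t; exact Hz |]].
  (* Separators are pairwise disjoint, so [z] lies on at most one of them and in at most two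
     domains. *)
  - destruct (classic (exists e, al e = t /\ A (fst e) z)) as [(e0 & <- & H0) | N].
    + exists (al e0 :: om e0 :: nil); intros s Hs.
      destruct (shared_point _ s z Hz Hs) as [<- | (e & E & <- & He)]; [simpl; auto |].
      destruct (same_index_edges e e0) as [-> | ->]; [| simpl; auto |].
      * exact (separators_disjoint _ _ z He H0).
      * exfalso; rewrite al_bar in E; exact (loopless e0 (eq_sym E)).
    + exists (t :: nil); intros s Hs.
      destruct (shared_point _ s z Hz Hs) as [<- | (e & <- & <- & He)]; [simpl; auto |].
      exfalso; eauto.
  - intros u v p Hu Hv P e He.
    destruct (shared_path _ _ z _ P Hu Hv) as [-> | (f & -> & _)]; [contradiction |].
    destruct P as (_ & _ & P); destruct He as [<- | []].
    simpl in P; change (dom (om f) z); now rewrite P.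
Qed.

(* [U] is the part of a ball around [z] in the partial union that avoids every outer separator
   [A e] whose outer halfspace [H e] leaves the ball. *)
Lemma lim_map_continuous_point i (O : X -> Prop) (t : CV A Y Z) z :
  metric_open dist O -> dom t z -> O z ->
  exists F U, @finite_subtree Th F /\ @admissible Th F U /\ @Gset Th F U (@LPt Th (t, z)) /\
    forall y, @Gset Th F U y -> lim_valid y /\ O (lim_map i y).
Proof.
  intros HO Hz Oz; destruct (HO z Oz) as (eps & He & HB).
  set (F := fun s : CV A Y Z => dom s z).
  pose proof (shared_subtree z t Hz) as Fs; fold F in Fs.
  set (B := fun y => dist z y < eps).
  set (U := fun p : CV A Y Z * X => F (fst p) /\ dom (fst p) (snd p) /\ B (snd p) /\
    forall e, @NF Th F e -> A (fst e) (snd p) -> incl_set (H e) B).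
  (* Distinct outer edges have disjoint separators, so whether the separator of [e] lies in [U]
     depends on the halfspace of [e] alone. *)
  assert (Same : forall e e' x, @NF Th F e -> @NF Th F e' ->
    A (fst e) x -> A (fst e') x -> e = e').
  { intros e e' x [_ Fo] [Fa' _] Ha Ha'.
    destruct (same_index_edges e e' (separators_disjoint _ _ x Ha Ha')) as [E | ->]; auto.
    exfalso; exact (Fo Fa'). }
  exists F, U; split; [exact Fs |]; split; [split; [| split; [| split]] | split].
  - intros p (U1 & U2 & _); split; assumption.
  - intros e [s x] _ Fo [_ Ha] (_ & _ & U3 & U4); split; [exact Fo |].
    split; [now apply separator_om | split; assumption].
  - intros [s x] (U1 & U2 & U3 & U4); simpl in *.
    (* A halfspace that leaves the ball has a point at distance at least [eps - dist z x] from [x],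
       the bound passed to [avoid_outer_halves]. *)
    assert (H0 : 0 < eps - dist z x) by (unfold B in U3; lra).
    destruct (avoid_outer_halves Fs (fun e => @NF Th F e /\ ~ incl_set (H e) B) x _ H0)
      as (eps1 & H1 & Hav).
    { intros e [Ne Nb]; split; [| split]; auto.
      - intro Hx; apply Nb, U4; auto; apply half_inter; split; auto.
        exact (subtree_side Fs s e U1 Ne x U2).
      - apply NNPP; intro N; apply Nb; intros w Hw; unfold B; apply Rnot_le_lt; intro D.
        apply N; exists w; split; auto; pose proof (dist_triangle Hm z x w); lra. }
    exists (Rmin (eps - dist z x) eps1); split; [now apply Rmin_pos |].
    pose proof (Rmin_l (eps - dist z x) eps1) as M1; pose proof (Rmin_r (eps - dist z x) eps1) as M2.
    intros [s' y] [E Hy] D; simpl in *; subst s'; split; [exact U1 |]; split; [exact Hy |]; simpl.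
    split; [unfold B; pose proof (dist_triangle Hm z x y); lra |].
    intros e Ne Ha; apply NNPP; intro Nb; apply (Hav e y); [split; auto | lra |].
    now apply separator_half.
  - intros e Ne; destruct (classic (incl_set (H e) B)) as [Hb | Nb].
    + left; intros [s x] [E Ha]; simpl in *; subst s.
      split; [apply Ne |]; split; [now apply separator_al |]; simpl.
      split; [apply Hb; now apply separator_half |].
      intros e' Ne' Ha'; now rewrite (Same e' e x).
    + right; intros [s x] [E Ha] (_ & _ & _ & U4); exact (Nb (U4 e Ne Ha)).
  - split; [exact Hz | left]; split; [exact Hz |]; split; [exact Hz |]; simpl.
    split; [unfold B; now rewrite (dist_self Hm) |].
    intros e [_ Fo] Ha; exfalso; apply Fo; now apply separator_om.
  - intros y Gy; apply (Gset_sub F U i O y Fs); auto.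
    + intros p (_ & _ & U3 & _); apply HB, U3.
    + intros e Ne HS x Hx; apply HB.
      destruct (separator_nonempty (fst e)) as [a Ha].
      destruct (HS (al e, a) (conj eq_refl Ha)) as (_ & _ & _ & U4); exact (U4 e Ne Ha x Hx).
Qed.

(** The subtree is the single vertex [om (r N)], with [N] so large that [H (r N)] fits into [O], and
    [U] is its domain without the separator of [r N]. The only outer edge whose separator is not in
    [U] is [bar (r N)], so the image of the basic set stays in [H (r N)]. *)
Lemma lim_map_continuous_end i (O : X -> Prop) r : metric_open dist O -> @is_ray Th r ->
  O (lim_map i (LEnd r)) ->
  exists F U, @finite_subtree Th F /\ @admissible Th F U /\ @Gset Th F U (@LEnd Th r) /\
    forall y, @Gset Th F U y -> lim_valid y /\ O (lim_map i y).
Proof.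
  intros HO Hr Oz; destruct (HO _ Oz) as (eps & He & HB).
  pose proof (proj1 (ray_chain r) Hr) as c.
  destruct (chain_small r eps c He) as [N HN].
  assert (HNO : incl_set (H (r N)) O).
  { intros x Hx; apply HB, (HN N); auto; now apply lim_map_end. }
  set (F := fun s : CV A Y Z => s = om (r N)).
  set (U := fun p : CV A Y Z * X =>
    fst p = om (r N) /\ dom (fst p) (snd p) /\ ~ A (fst (r N)) (snd p)).
  assert (Fs : @finite_subtree Th F).
  { split; [| split].
    - exists (om (r N) :: nil); intros s ->; simpl; auto.
    - exists (om (r N)); reflexivity.
    - intros u v p -> -> P e Hin.
      rewrite (path_unique (om (r N)) (om (r N)) None nil p eq_refl P) in Hin; contradiction. }
  assert (HIn : forall e, al e = om (r N) -> e <> bar (r N) -> incl_set (tsSig Th e) U).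
  { intros e E Ne [s x] [Es Ha]; simpl in *; subst s; split; [exact E |].
    split; [now apply separator_al |]; simpl; intro Ha'.
    destruct (same_index_edges _ _ (separators_disjoint _ _ x Ha Ha')) as [-> | ->]; auto.
    exact (loopless _ E). }
  exists F, U; split; [exact Fs |]; split; [split; [| split; [| split]] | split].
  - intros p (U1 & U2 & _); split; assumption.
  - intros e p Fa Fo _ _; exfalso; apply (loopless e).
    exact (eq_trans Fa (eq_sym Fo)).
  - intros [s x] (U1 & U2 & U3).
    destruct (compact_avoid Hm _ x (separator_compact (fst (r N))) U3) as (eps1 & H1 & Hy).
    exists eps1; split; auto; intros [s' y] [E Hy'] D; simpl in *; subst s'.
    split; [exact U1 |]; split; [exact Hy' | exact (Hy y D)].
  - intros e [Fa Fo]; destruct (classic (e = bar (r N))) as [-> | Ne].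
    + right; intros p [_ Ha] (_ & _ & U3); exact (U3 Ha).
    + left; now apply HIn.
  - split; auto; exists (r (S N)); destruct (Hr N) as [E Ne].
    split; [split | split].
    + symmetry; exact E.
    + intro Fo; apply (loopless (r (S N))); exact (eq_trans (eq_sym E) (eq_sym Fo)).
    + apply HIn; auto; symmetry; exact E.
    (* [al (r (S n))] is [om (r n)], so these vertices lie beyond [r (S N)] from index [S (S N)]
       on. *)
    + exists (S (S N)); intros [| n] Hn; [lia |].
      apply beyond_iff; change (tsal (r (S n))) with (al (r (S n))).
      rewrite <- (cov_om _ _ (c n)); intros x Hx; apply dom_om in Hx.
      apply (chain_sub r (S N) n); auto; lia.
  - intros y Gy; apply (Gset_sub F U i O y Fs); auto.
    + intros [s x] (U1 & U2 & _); simpl in *; subst s; apply HNO; now apply dom_om.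
    + intros e [Fa Fo] HS x Hx; apply HNO, (lt_sub e); auto.
      apply om_cov; [symmetry; exact Fa |].
      intros ->; destruct (separator_nonempty (fst (r N))) as [a Ha].
      destruct (HS (al (bar (r N)), a) (conj eq_refl Ha)) as (_ & _ & U3); exact (U3 Ha).
Qed.

Lemma lim_map_homeo i : inhabited L -> @lim_homeo Th X dist (lim_map i).
Proof.
  intro HL; split; [| split; [| split]].
  - intros x y; apply lim_map_injective.
  - intro z; now apply lim_map_surjective.
  - intros O HO [[t z] | r] [V Oz].
    + now apply lim_map_continuous_point.
    + now apply lim_map_continuous_end.
  - intros W HW; now apply lim_map_open.
Qed.

End Decomposition.

Theorem theorem3 (X : Type) (dist : X -> X -> R) (L : Type)
    (A Y Z : L -> X -> Prop) :
  is_metric_on dist (fun _ => True) ->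
  compact_sub dist (fun _ => True) ->
  inhabited L ->
  tree_decomposition dist A Y Z ->
  fine_decomposition dist Y Z ->
  tree_system_mc (ThetaC dist A Y Z) /\
  exists h : LimPt (ThetaC dist A Y Z) -> X,
    (forall (Om : CV A Y Z) (x : X), proj1_sig Om x -> h (@LPt (ThetaC dist A Y Z) (Om, x)) = x) /\
    (forall r : nat -> L * bool, @is_ray (ThetaC dist A Y Z) r ->
       forall y, (forall i, half Y Z (r i) y) <-> y = h (@LEnd (ThetaC dist A Y Z) r)) /\
    lim_homeo X dist h.
Proof.
  intros Hm HX HL HT HF; split; [now apply ThetaC_tree_system |].
  assert (i : inhabited X).
  { destruct HL as [l]; destruct (separator_nonempty HT l) as [x _]; exact (inhabits x). }
  exists (lim_map i); split; [| split].
  - reflexivity.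
  - intros r Hr y; now apply (lim_map_end_unique HT Hm HX HF).
  - now apply lim_map_homeo.
Qed.
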